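(* Let $\xi$ be an irrational real number, and suppose that for some integer $b\ge 2$ the base-$b$ expansion of $\xi$ is an automatic (resp. morphic) infinite word over the alphabet $\{0,1,\ldots,b-1\}$. Then $v_b(\xi)$ is finite and rational (resp. algebraic).
   Context: For a real $x$, $\|x\|$ denotes the distance from $x$ to the nearest integer. For an irrational real $\xi$ and integer $b\ge 2$, $v_b(\xi)$ is the supremum of the real numbers $v$ such that $\|b^n\xi\|<(b^n)^{-v}$ has infinitely many solutions in positive integers $n$. The base-$b$ expansion of $\xi$ is the digit sequence $d_1d_2d_3\cdots$ with $d_n\in\{0,\dots,b-1\}$, not ending in $(b-1)^\omega$, such that $\xi=\lfloor\xi\rfloor+\sum_{n\ge1}d_nb^{-n}$. Morphic/automatic words: Let $\Sigma$ be a finite alphabet and $\epsilon$ the empty word. A morphism $h:\Sigma^*\to\Sigma^*$ is prolongable on $a\in\Sigma$ if $h(a)=ax$ with $x\in\Sigma^+$ and $h^n(x)\ne\epsilon$ for all $n\ge0$; then $h^n(a)$ converges to the infinite word $h^\omega(a)=a\,x\,h(x)\,h^2(x)\cdots$, a fixed point of $h$, called a pure morphic word. A coding is a letter-to-letter morphism. An infinite word is morphic if it is the image under a coding of a pure morphic word, and automatic if it is the image under a coding of a pure morphic word $h^\omega(a)$ with $h$ uniform (i.e. $|h(c)|$ is the same for all letters $c$). *)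

(* Defs.v *)
From Stdlib Require Import Reals Lra Lia ZArith Arith List.
Open Scope R_scope.

(* floor of a real: up x is the unique integer with x < up x <= x + 1 *)
Definition floorR (x : R) : Z := (up x - 1)%Z.

Definition dist_int (x : R) : R :=
  Rmin (x - IZR (floorR x)) (IZR (floorR x) + 1 - x).

Definition is_rational (x : R) : Prop :=
  exists p q : Z, q <> 0%Z /\ x = IZR p / IZR q.

Definition eval_Zpoly (l : list Z) (x : R) : R :=
  fold_right (fun c acc => IZR c + x * acc) 0 l.

Definition is_algebraic (x : R) : Prop :=
  exists l : list Z, (exists c, In c l /\ c <> 0%Z) /\ eval_Zpoly l x = 0.

Definition approx_exponents (b : nat) (xi : R) (v : R) : Prop :=
  forall N : nat, exists n : nat, (N < n)%nat /\
    dist_int (INR b ^ n * xi) < Rpower (INR b ^ n) (- v).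

Definition vb_equals (b : nat) (xi r : R) : Prop :=
  is_lub (approx_exponents b xi) r.

(* d : nat -> nat is the base-b expansion d_1 d_2 ... of xi, with d 0 = d_1 *)
Definition is_base_expansion (b : nat) (xi : R) (d : nat -> nat) : Prop :=
  (forall n, (d n < b)%nat) /\
  ~ (exists N, forall n, (N <= n)%nat -> d n = (b - 1)%nat) /\
  infinite_sum (fun n => INR (d n) / INR b ^ (S n)) (xi - IZR (floorR xi)).

Definition morph (h : nat -> list nat) (w : list nat) : list nat :=
  flat_map h w.

Definition is_morphism (k : nat) (h : nat -> list nat) : Prop :=
  forall c, (c < k)%nat -> forall y, In y (h c) -> (y < k)%nat.

Definition prolongable (h : nat -> list nat) (a : nat) : Prop :=
  exists x : list nat, h a = a :: x /\ x <> nil /\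
    forall n : nat, Nat.iter n (morph h) x <> nil.

Definition is_fixed_point_word (h : nat -> list nat) (a : nat) (u : nat -> nat) : Prop :=
  prolongable h a /\
  forall n i, (i < length (Nat.iter n (morph h) (a :: nil)))%nat ->
    u i = nth i (Nat.iter n (morph h) (a :: nil)) 0%nat.

Definition uniform (k : nat) (h : nat -> list nat) : Prop :=
  exists L, forall c, (c < k)%nat -> length (h c) = L.

Definition is_morphic_word (w : nat -> nat) : Prop :=
  exists (k : nat) (h : nat -> list nat) (a : nat) (tau : nat -> nat) (u : nat -> nat),
    is_morphism k h /\ (a < k)%nat /\ is_fixed_point_word h a u /\
    forall n, w n = tau (u n).

Definition is_automatic_word (w : nat -> nat) : Prop :=
  exists (k : nat) (h : nat -> list nat) (a : nat) (tau : nat -> nat) (u : nat -> nat),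
    is_morphism k h /\ uniform k h /\ (a < k)%nat /\ is_fixed_point_word h a u /\
    forall n, w n = tau (u n).

(* Main.v *)
(** Let [l n] be the length of the longest run of digits [0], or of digits
    [b - 1], starting at position [n] of the expansion.  Then [||b^n xi||] is
    [b^(- l n)] up to a factor [b], so [v_b xi] is the limsup of [l n / n].

    Let [u] be the fixed point of [h] and [Z] the set of letters coded by the
    digit in question.  The sets of letters [c] with [h^t c] in [Z^*] are
    eventually periodic in [t], so for a suitable power [g] of [h] the set
    [Z1] of letters [c] with [g^t c] in [Z^*] is the same for all [t > 0].
    A long maximal run of [Z] in [u] is then obtained, by applying some [g^t],
    from a word of [Z1^*] lying between two letters outside [Z1] in the image
    [g c] of a single letter [c = u m].  There are finitely many such gaps up
    to the choice of [m], and the first occurrence of [c] gives the largest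
    ratio length/start.

    The lengths and starts coming from one gap are linear forms in a sequence
    of vectors [X t = M^t X 0] with [M] a nonnegative integer matrix, and one
    coordinate of [X] dominates all entries of [M^t].  For a power [A] of [M]
    whose zero pattern is idempotent, [K A^2 >= A], which forces the only
    eigenvalue of maximal modulus to be that modulus itself.  Hence all linear
    forms are [th^t Q(t) + O(mu^t)] with [mu < th] and [Q] a polynomial with
    algebraic coefficients, and their ratios converge to algebraic numbers.
    If [h] is uniform, lengths and starts are [r K^t + O(1)] with [r] rational. *)
Require Import Defs.
From Stdlib Require Import Reals Lra Lia ZArith Arith List Classical.
From mathcomp Require all_boot all_order all_algebra all_field Rstruct zify.
Open Scope R_scope.

(** * Base-b expansions and runs of extreme digits *)

Section Expansion.
Variables (xi : R) (b : nat) (d : nat -> nat).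
Hypothesis xi_irrational : ~ is_rational xi.
Hypothesis b_ge2 : (2 <= b)%nat.
Hypothesis d_exp : is_base_expansion b xi d.

Let b_ge2R : 2 <= INR b.
Proof. now apply (le_INR 2 b). Qed.

Lemma pow_b_pos n : 0 < INR b ^ n.
Proof. apply pow_lt; lra. Qed.

Lemma infinite_sum_shift (e : nat -> nat) x :
  infinite_sum (fun m => INR (e m) / INR b ^ S m) x ->
  infinite_sum (fun m => INR (e (S m)) / INR b ^ S m) (INR b * x - INR (e O)).
Proof.
intros H eps Heps.
destruct (H (eps / INR b)) as [N HN]; [apply Rdiv_lt_0_compat; lra|].
exists N; intros n Hn. specialize (HN (S n) ltac:(lia)).
rewrite decomp_sum in HN by lia. simpl pred in HN.
assert (E : sum_f_R0 (fun i => INR (e (S i)) / INR b ^ S (S i)) n * INR b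
  = sum_f_R0 (fun m => INR (e (S m)) / INR b ^ S m) n).
{ rewrite Rmult_comm, scal_sum. apply sum_eq. intros i _.
  pose proof (pow_b_pos i). simpl. field. split; [apply pow_nonzero|]; lra. }
unfold Rdist in *. rewrite <- E.
replace (_ - _) with (INR b * (INR (e O) / INR b ^ 1 +
  sum_f_R0 (fun i => INR (e (S i)) / INR b ^ S (S i)) n - x)) by (simpl; field; lra).
rewrite Rabs_mult, (Rabs_pos_eq (INR b)) by lra.
apply Rmult_lt_compat_l with (r := INR b) in HN; [|lra].
replace (INR b * (eps / INR b)) with eps in HN by (field; lra). exact HN.
Qed.

(** A partial sum is at most its value for digits all equal to [b - 1], which telescopes to
    [1 - / b^(n+1)]; both bounds survive in the limit. *)
Lemma infinite_sum_digits_bounds (e : nat -> nat) x : (forall n, (e n < b)%nat) ->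
  infinite_sum (fun m => INR (e m) / INR b ^ S m) x -> 0 <= x <= 1.
Proof.
intros He H.
assert (P : forall n, 0 <= sum_f_R0 (fun m => INR (e m) / INR b ^ S m) n <= 1 - / INR b ^ S n).
{ assert (T : forall n, 0 <= INR (e n) / INR b ^ S n <= (INR b - 1) / INR b ^ S n).
  { intro n. pose proof (pow_b_pos (S n)). split.
    - apply Rmult_le_pos; [apply pos_INR|]. left; now apply Rinv_0_lt_compat.
    - apply Rmult_le_compat_r; [left; now apply Rinv_0_lt_compat|].
      pose proof (He n). assert (INR (e n + 1) <= INR b) by (apply le_INR; lia).
      rewrite plus_INR in H2. simpl in H2. lra. }
  intro n. induction n as [|n IH].
  - simpl sum_f_R0. specialize (T O). simpl in *.
    replace (1 - / (INR b * 1)) with ((INR b - 1) / (INR b * 1)) by (field; lra). lra.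
  - rewrite tech5. specialize (T (S n)).
    replace (1 - / INR b ^ S (S n)) with ((1 - / INR b ^ S n) + (INR b - 1) / INR b ^ S (S n)).
    + lra.
    + pose proof (pow_b_pos n). simpl. field. split; [apply pow_nonzero|]; lra. }
split; apply Rnot_lt_le; intro C.
- destruct (H (- x)) as [N HN]; [lra|]. specialize (HN N (le_n N)). specialize (P N).
  unfold Rdist in HN. apply Rabs_def2 in HN. lra.
- destruct (H (x - 1)) as [N HN]; [lra|]. specialize (HN N (le_n N)). specialize (P N).
  pose proof (Rinv_0_lt_compat _ (pow_b_pos (S N))).
  unfold Rdist in HN. apply Rabs_def2 in HN. lra.
Qed.

(** This is the fractional part of [b^n xi], defined by the digit shift so that removing one digit
    is a computation; [remainder_integer] and [remainder_bounds] justify the reading. *)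
Fixpoint remainder (n : nat) : R :=
  match n with
  | O => xi - IZR (floorR xi)
  | S n => INR b * remainder n - INR (d n)
  end.

Lemma remainder_sum n :
  infinite_sum (fun m => INR (d (n + m)%nat) / INR b ^ S m) (remainder n).
Proof.
destruct d_exp as [_ [_ H]].
induction n as [|n IH]; [exact H|].
apply infinite_sum_shift in IH. simpl remainder.
rewrite Nat.add_0_r in IH. intros eps Heps. destruct (IH eps Heps) as [N HN].
exists N. intros m Hm. rewrite (sum_eq _ (fun m => INR (d (n + S m)) / INR b ^ S m)).
- exact (HN m Hm).
- intros i _. now replace (n + S i)%nat with (S n + i)%nat by lia.
Qed.

Lemma remainder_integer n : exists z, remainder n = INR b ^ n * xi - IZR z.
Proof.
induction n as [|n [z Hz]].
- exists (floorR xi). simpl. ring.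
- exists (Z.of_nat b * z + Z.of_nat (d n))%Z.
  rewrite plus_IZR, mult_IZR, <- !INR_IZR_INZ. simpl. rewrite Hz. ring.
Qed.

Lemma remainder_not_integer n z : remainder n <> IZR z.
Proof.
intro E. destruct (remainder_integer n) as [z' Hz]. apply xi_irrational.
exists (z + z')%Z, (Z.of_nat b ^ Z.of_nat n)%Z.
assert (Q : IZR (Z.of_nat b ^ Z.of_nat n) = INR b ^ n) by now rewrite <- pow_IZR, <- INR_IZR_INZ.
pose proof (pow_b_pos n). split.
- intro C. rewrite C in Q. lra.
- rewrite Q, plus_IZR. replace (IZR z + IZR z') with (INR b ^ n * xi) by lra. field. lra.
Qed.

(** The digit series gives the closed interval; irrationality excludes its end points. *)
Lemma remainder_bounds n : 0 < remainder n < 1.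
Proof.
pose proof (infinite_sum_digits_bounds _ _ (fun m => proj1 d_exp (n + m)%nat) (remainder_sum n)).
pose proof (remainder_not_integer n 0). pose proof (remainder_not_integer n 1). lra.
Qed.

Lemma dist_int_remainder n :
  dist_int (INR b ^ n * xi) = Rmin (remainder n) (1 - remainder n).
Proof.
destruct (remainder_integer n) as [z Hz]. pose proof (remainder_bounds n).
assert (E : floorR (INR b ^ n * xi) = z).
{ unfold floorR. rewrite <- (tech_up _ (z + 1)); [lia| |]; rewrite plus_IZR; lra. }
unfold dist_int. rewrite E. f_equal; lra.
Qed.

Lemma remainder_digit n : remainder n = (INR (d n) + remainder (S n)) / INR b.
Proof. simpl. field. lra. Qed.

Definition constant_run (c i l : nat) := forall n, (i <= n < i + l)%nat -> d n = c.

Lemma constant_run_S c i l : constant_run c i (S l) <-> d i = c /\ constant_run c (S i) l.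
Proof.
split.
- intro H. split; [apply H; lia|]. intros n Hn. apply H. lia.
- intros [H0 H] n Hn. destruct (Nat.eq_dec n i) as [->|]; [exact H0|]. apply H. lia.
Qed.

Lemma INR_pred_b : INR (b - 1) = INR b - 1.
Proof. rewrite minus_INR by lia. reflexivity. Qed.

Lemma inv_pow_b_S l : / INR b ^ S l = / INR b ^ l / INR b.
Proof. pose proof (pow_b_pos l). simpl. field. split; [apply pow_nonzero|]; lra. Qed.

Lemma zero_run_remainder n l : constant_run 0 n l -> remainder n <= / INR b ^ l.
Proof.
revert n. induction l as [|l IH]; intros n H.
- simpl. rewrite Rinv_1. pose proof (remainder_bounds n). lra.
- apply constant_run_S in H. destruct H as [H0 H]. apply IH in H.
  rewrite remainder_digit, H0, inv_pow_b_S. simpl INR.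
  apply Rmult_le_compat_r; [left; apply Rinv_0_lt_compat|]; lra.
Qed.

Lemma top_run_remainder n l : constant_run (b - 1) n l -> 1 - remainder n <= / INR b ^ l.
Proof.
revert n. induction l as [|l IH]; intros n H.
- simpl. rewrite Rinv_1. pose proof (remainder_bounds n). lra.
- apply constant_run_S in H. destruct H as [H0 H]. apply IH in H.
  rewrite remainder_digit, H0, inv_pow_b_S, INR_pred_b.
  replace (1 - (INR b - 1 + remainder (S n)) / INR b) with ((1 - remainder (S n)) / INR b)
    by (field; lra).
  apply Rmult_le_compat_r; [left; apply Rinv_0_lt_compat|]; lra.
Qed.

(** Multiplying by [b] leaves [d n + remainder (S n)] below [1], which forces the digit [0]; the
    rest is the same statement one position later. *)
Lemma remainder_zero_run n l : remainder n < / INR b ^ l -> constant_run 0 n l.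
Proof.
revert n. induction l as [|l IH]; intros n H; [intros m Hm; lia|].
pose proof (remainder_bounds (S n)).
assert (Q : INR (d n) + remainder (S n) < / INR b ^ l).
{ rewrite remainder_digit, inv_pow_b_S in H.
  apply Rmult_lt_reg_r with (/ INR b); [apply Rinv_0_lt_compat; lra|exact H]. }
assert (R1 : / INR b ^ l <= 1).
{ rewrite <- Rinv_1. apply Rinv_le_contravar; [lra|]. apply pow_R1_Rle. lra. }
assert (d n = O).
{ destruct (d n) as [|m]; [reflexivity|]. rewrite S_INR in Q. pose proof (pos_INR m). lra. }
apply constant_run_S. split; [assumption|]. apply IH. rewrite H1 in Q. simpl INR in Q. lra.
Qed.

Lemma remainder_top_run n l : 1 - remainder n < / INR b ^ l -> constant_run (b - 1) n l.
Proof.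
revert n. induction l as [|l IH]; intros n H; [intros m Hm; lia|].
pose proof (remainder_bounds (S n)).
assert (Q : INR b - 1 - INR (d n) + (1 - remainder (S n)) < / INR b ^ l).
{ rewrite remainder_digit, inv_pow_b_S in H.
  apply Rmult_lt_reg_r with (/ INR b); [apply Rinv_0_lt_compat; lra|].
  replace ((INR b - 1 - INR (d n) + (1 - remainder (S n))) * / INR b)
    with (1 - (INR (d n) + remainder (S n)) / INR b) by (field; lra). exact H. }
assert (R1 : / INR b ^ l <= 1).
{ rewrite <- Rinv_1. apply Rinv_le_contravar; [lra|]. apply pow_R1_Rle. lra. }
assert (d n = b - 1)%nat.
{ pose proof (proj1 d_exp n). apply NNPP. intro C.
  assert (L : (d n + 2 <= b)%nat) by lia. apply le_INR in L. rewrite plus_INR in L.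
  simpl in L. lra. }
apply constant_run_S. split; [assumption|]. apply IH. rewrite H1, INR_pred_b in Q. lra.
Qed.

Lemma inv_pow_b_small eps : 0 < eps -> exists l, / INR b ^ l < eps.
Proof.
intro He. destruct (Pow_x_infinity (INR b)) with (b := / eps + 1) as [N HN].
- rewrite Rabs_pos_eq; lra.
- exists N. specialize (HN N (le_n N)).
  rewrite Rabs_pos_eq in HN by (left; apply pow_b_pos).
  rewrite <- (Rinv_inv eps). apply Rinv_lt_contravar; [|lra].
  apply Rmult_lt_0_compat; [now apply Rinv_0_lt_compat|apply pow_b_pos].
Qed.

(** A tail of zeros would push the positive number [remainder n] below every [/ b^l]. *)
Lemma zero_digits_not_cofinite n : exists m, (n <= m)%nat /\ d m <> O.
Proof.
apply NNPP. intro C. pose proof (remainder_bounds n).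
destruct (inv_pow_b_small (remainder n)) as [l Hl]; [lra|].
assert (remainder n <= / INR b ^ l); [|lra].
apply zero_run_remainder. intros m Hm. apply NNPP. intro E. apply C. exists m. split; [lia|exact E].
Qed.

Lemma top_digits_not_cofinite n : exists m, (n <= m)%nat /\ d m <> (b - 1)%nat.
Proof.
apply NNPP. intro C. apply (proj1 (proj2 d_exp)). exists n. intros m Hm.
apply NNPP. intro E. apply C. exists m. now split.
Qed.

Definition extreme_run i l := constant_run 0 i l \/ constant_run (b - 1) i l.

Lemma Rpower_pow_b n v : Rpower (INR b ^ n) (- v) = Rpower (INR b) (- (INR n * v)).
Proof.
rewrite <- Rpower_pow by lra. rewrite Rpower_mult. f_equal. ring.
Qed.

Lemma inv_pow_b_Rpower l : / INR b ^ l = Rpower (INR b) (- INR l).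
Proof. rewrite Rpower_Ropp, Rpower_pow by lra. reflexivity. Qed.

Lemma run_close n l v : extreme_run n l -> INR n * v < INR l ->
  dist_int (INR b ^ n * xi) < Rpower (INR b ^ n) (- v).
Proof.
intros H Hl. rewrite dist_int_remainder, Rpower_pow_b.
apply Rle_lt_trans with (/ INR b ^ l).
- destruct H as [H|H].
  + eapply Rle_trans; [apply Rmin_l|now apply zero_run_remainder].
  + eapply Rle_trans; [apply Rmin_r|now apply top_run_remainder].
- rewrite inv_pow_b_Rpower. apply Rpower_lt; lra.
Qed.

(** Converse of [run_close] up to rounding of [n * v]. The smaller of the two distances tells which
    extreme digit is repeated. *)
Lemma close_run n l v : dist_int (INR b ^ n * xi) < Rpower (INR b ^ n) (- v) ->
  INR l <= INR n * v -> extreme_run n l.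
Proof.
rewrite dist_int_remainder, Rpower_pow_b. intros H Hl.
assert (Q : Rmin (remainder n) (1 - remainder n) < / INR b ^ l).
{ eapply Rlt_le_trans; [exact H|]. rewrite inv_pow_b_Rpower. apply Rle_Rpower; lra. }
unfold Rmin in Q. destruct (Rle_dec _ _) in Q.
- left. now apply remainder_zero_run.
- right. now apply remainder_top_run.
Qed.

Lemma nat_floor x : 0 <= x -> exists l : nat, INR l <= x < INR l + 1.
Proof.
intro Hx. destruct (archimed x) as [H1 H2]. exists (Z.to_nat (up x - 1)).
assert (0 < up x)%Z by (apply lt_IZR; lra).
rewrite INR_IZR_INZ, Z2Nat.id by lia. rewrite minus_IZR. lra.
Qed.

(** An empty run is already good enough when [v < 0]. Hence no negative number bounds the exponents,
    which settles the case of supremum [0]. *)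
Lemma negative_approx v : v < 0 -> approx_exponents b xi v.
Proof.
intros Hv N. exists (S N). split; [lia|].
apply (run_close (S N) 0).
- left. intros n Hn. lia.
- change (INR 0) with 0. apply Rmult_pos_neg; [|exact Hv]. rewrite S_INR. pose proof (pos_INR N). lra.
Qed.

(** * The exponent as a maximum over finitely many families of runs *)

Section Family.
Variable Alg : R -> Prop.
Hypothesis Alg0 : Alg 0.
(** Each pair [(D, I)] is a family of runs with lengths [D t] and starts [I t]. By [G_cover], every
    run that is not short is beaten by a member of some family: one at least as long that starts no
    later. *)
Variable G : list ((nat -> nat) * (nat -> nat)).
Hypothesis G_lim : forall D I, In (D, I) G ->
  exists r, Alg r /\ Un_cv (fun t => INR (D t) / INR (I t)) r.
Hypothesis G_inf : forall D I, In (D, I) G -> forall N, exists T, forall t, (T <= t)%nat -> (N <= I t)%nat.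
Hypothesis G_run : forall D I, In (D, I) G -> forall t, extreme_run (I t) (D t).
Hypothesis G_cover : forall T, exists K, forall i l, extreme_run i l ->
  (l <= K)%nat \/ exists D I t, In (D, I) G /\ (T <= t)%nat /\ (I t <= i)%nat /\ (l <= D t)%nat.

(** The number [L] is the maximum of [0] and the limits. The induction runs over a sublist [H] so
    that the hypotheses on [G] stay fixed. *)
Lemma family_max (H : list ((nat -> nat) * (nat -> nat))) : (forall p, In p H -> In p G) ->
  exists L, 0 <= L /\ Alg L /\
  (L = 0 \/ exists D I, In (D, I) H /\ Un_cv (fun t => INR (D t) / INR (I t)) L) /\
  forall D I r, In (D, I) H -> Un_cv (fun t => INR (D t) / INR (I t)) r -> r <= L.
Proof.
induction H as [|[D I] H IH]; intro sub.
- exists 0. split; [lra|]. split; [exact Alg0|]. split; [now left|]. intros ? ? ? [].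
- destruct IH as [L [L0 [LA [LH Lmax]]]]; [intros p Hp; apply sub; now right|].
  destruct (G_lim D I) as [r [rA Hr]]; [apply sub; now left|].
  destruct (Rle_dec r L) as [C|C].
  + exists L. repeat split; try assumption.
    * destruct LH as [->|[D' [I' [h1 h2]]]]; [now left|right]. exists D', I'. split; [now right|exact h2].
    * intros D' I' r' [E|HH] Hr'; [|now apply (Lmax D' I')].
      injection E as -> ->. rewrite (UL_sequence _ _ _ Hr' Hr). exact C.
  + exists r. split; [lra|]. split; [exact rA|]. split.
    * right. exists D, I. split; [now left|exact Hr].
    * intros D' I' r' [E|HH] Hr'.
      -- injection E as -> ->. right. exact (UL_sequence _ _ _ Hr' Hr).
      -- specialize (Lmax D' I' r' HH Hr'). lra.
Qed.

Lemma family_eventually (L eps : R) (H : list ((nat -> nat) * (nat -> nat))) : 0 < eps ->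
  (forall p, In p H -> In p G) ->
  (forall D I r, In (D, I) H -> Un_cv (fun t => INR (D t) / INR (I t)) r -> r <= L) ->
  exists T, forall D I t, In (D, I) H -> (T <= t)%nat -> INR (D t) <= (L + eps) * INR (I t).
Proof.
intro He. induction H as [|[D I] H IH]; intros sub HL.
- exists O. intros ? ? ? [].
- destruct IH as [T1 HT1].
  { intros p Hp; apply sub; now right. }
  { intros D' I' r' h. apply HL. now right. }
  destruct (G_lim D I) as [r [_ Hr]]; [apply sub; now left|].
  specialize (HL D I r (or_introl eq_refl) Hr).
  destruct (Hr eps He) as [T2 HT2].
  destruct (G_inf D I (sub _ (or_introl eq_refl)) 1%nat) as [T3 HT3].
  exists (T1 + T2 + T3)%nat. intros D' I' t [E|HH] Ht; [|apply HT1; [assumption|lia]].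
  injection E as <- <-. specialize (HT2 t ltac:(lia)). specialize (HT3 t ltac:(lia)).
  apply (le_INR 1) in HT3. simpl in HT3. unfold Rdist in HT2. apply Rabs_def2 in HT2.
  replace (INR (D t)) with (INR (D t) / INR (I t) * INR (I t)) by (field; lra).
  apply Rmult_le_compat_r; lra.
Qed.

(** An exponent [v > L] would give runs at [n] of length about [n * v], but covering families allow
    at most [(L + eps) * n]. Conversely, a family with limit [L] realizes exponents arbitrarily
    close to [L]. *)
Theorem vb_of_runs : exists r, vb_equals b xi r /\ Alg r.
Proof.
destruct (family_max G) as [L [L0 [LA [LG Lmax]]]]; [auto|].
exists L. split; [|exact LA]. split.
- intros v Hv. apply Rnot_lt_le. intro C.
  set (eps := (v - L) / 2). assert (He : 0 < eps) by (unfold eps; lra).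
  destruct (family_eventually L eps G He) as [T HT]; [auto|exact Lmax|].
  destruct (G_cover T) as [K HK].
  (* [N1] gives [n * eps > 1], which absorbs the rounding of [n * v]; [N2] makes the run longer than
     [K], so the first alternative of [G_cover] fails. *)
  destruct (INR_unbounded (/ eps)) as [N1 HN1].
  destruct (INR_unbounded ((INR K + 1) / v)) as [N2 HN2].
  destruct (Hv (N1 + N2)%nat) as [n [Hn Hd]].
  assert (n1 : / eps < INR n) by (eapply Rlt_trans; [exact HN1|apply lt_INR; lia]).
  assert (n2 : (INR K + 1) / v < INR n) by (eapply Rlt_trans; [exact HN2|apply lt_INR; lia]).
  assert (n1' : 1 < INR n * eps).
  { apply Rmult_lt_compat_r with (r := eps) in n1; [|exact He]. rewrite Rinv_l in n1; lra. }
  assert (n2' : INR K + 1 < INR n * v).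
  { apply Rmult_lt_compat_r with (r := v) in n2; [|lra].
    unfold Rdiv in n2. rewrite Rmult_assoc, Rinv_l in n2; lra. }
  destruct (nat_floor (INR n * v)) as [l Hl]; [pose proof (pos_INR K); lra|].
  assert (run : extreme_run n l) by (eapply close_run; [exact Hd|lra]).
  destruct (HK n l run) as [le|[D [I [t [HG [Ht [HI HD]]]]]]].
  + apply le_INR in le. lra.
  + apply le_INR in HI. apply le_INR in HD. specialize (HT D I t HG Ht).
    assert ((L + eps) * INR (I t) <= (L + eps) * INR n) by (apply Rmult_le_compat_l; lra).
    assert (L + eps = v - eps) by (unfold eps; lra). nra.
- intros M HM. apply Rnot_lt_le. intro C.
  (* A negative bound [M] is refuted by the exponent [M / 2]. *)
  destruct (Rlt_dec M 0) as [M0|M0].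
  { assert (M / 2 <= M) by (apply HM, negative_approx; lra). lra. }
  destruct LG as [->|[D [I [HG HL]]]]; [lra|].
  assert ((M + L) / 2 <= M); [|lra].
  apply HM. intro N.
  destruct (HL ((L - M) / 2)) as [T1 HT1]; [lra|].
  destruct (G_inf D I HG (S N)) as [T2 HT2].
  set (t := (T1 + T2)%nat). specialize (HT1 t ltac:(lia)). specialize (HT2 t ltac:(lia)).
  exists (I t). split; [lia|]. apply run_close with (D t); [now apply G_run|].
  unfold Rdist in HT1. apply Rabs_def2 in HT1.
  assert (0 < INR (I t)) by (apply lt_0_INR; lia).
  apply Rmult_lt_reg_r with (/ INR (I t)); [now apply Rinv_0_lt_compat|].
  replace (INR (I t) * ((M + L) / 2) * / INR (I t)) with ((M + L) / 2) by (field; lra).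
  unfold Rdiv in HT1 at 3. lra.
Qed.
End Family.
End Expansion.

(** * Sequences of geometric growth with rational coefficient *)

Lemma rational_plus x y : is_rational x -> is_rational y -> is_rational (x + y).
Proof.
intros [p [q [Hq ->]]] [p' [q' [Hq' ->]]]. exists (p * q' + p' * q)%Z, (q * q')%Z.
split; [lia|]. rewrite plus_IZR, !mult_IZR. field. split; now apply not_0_IZR.
Qed.

Lemma rational_opp x : is_rational x -> is_rational (- x).
Proof.
intros [p [q [Hq ->]]]. exists (- p)%Z, q. split; [exact Hq|]. rewrite opp_IZR. field. now apply not_0_IZR.
Qed.

Lemma rational_div x y : is_rational x -> is_rational y -> y <> 0 -> is_rational (x / y).
Proof.
intros [p [q [Hq ->]]] [p' [q' [Hq' ->]]] Hy. exists (p * q')%Z, (q * p')%Z.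
assert (p' <> 0)%Z by (intros ->; apply Hy; unfold Rdiv; ring).
split; [lia|]. rewrite !mult_IZR. field. repeat split; now apply not_0_IZR.
Qed.

Section Geometric.
Variable K : nat.
(** Index [0] is left out because the recurrences for [lead] and [trail] only hold from [t = 1]
    on. *)
Definition geometric (f : nat -> nat) (r : R) :=
  is_rational r /\ exists B, forall t, (0 < t)%nat -> Rabs (INR (f t) - r * INR K ^ t) <= B.

Lemma geometric_plus f g r s : geometric f r -> geometric g s ->
  geometric (fun t => (f t + g t)%nat) (r + s).
Proof.
intros [Qr [B HB]] [Qs [C HC]]. split; [now apply rational_plus|].
exists (B + C). intros t Ht. rewrite plus_INR.
replace (_ - _) with ((INR (f t) - r * INR K ^ t) + (INR (g t) - s * INR K ^ t)) by ring.
eapply Rle_trans; [apply Rabs_triang|]. specialize (HB t Ht). specialize (HC t Ht). lra.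
Qed.

Lemma geometric_minus f g r s : (forall t, (g t <= f t)%nat) -> geometric f r -> geometric g s ->
  geometric (fun t => (f t - g t)%nat) (r - s).
Proof.
intros Hle [Qr [B HB]] [Qs [C HC]]. split; [now apply rational_plus, rational_opp|].
exists (B + C). intros t Ht. rewrite minus_INR by apply Hle.
replace (_ - _) with ((INR (f t) - r * INR K ^ t) + - (INR (g t) - s * INR K ^ t)) by ring.
eapply Rle_trans; [apply Rabs_triang|]. rewrite Rabs_Ropp.
specialize (HB t Ht). specialize (HC t Ht). lra.
Qed.

Lemma geometric_exact f c : (forall t, f t = (K ^ t * c)%nat) -> geometric f (INR c).
Proof.
intro H. split.
- exists (Z.of_nat c), 1%Z. split; [lia|]. rewrite <- INR_IZR_INZ. lra.
- exists 0. intros t _. rewrite H, mult_INR, pow_INR.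
  replace (_ - _) with 0 by ring. rewrite Rabs_R0. lra.
Qed.

(** With denominators cleared, the estimate can be proved by arithmetic in [nat]. *)
Lemma geometric_of_nat f p d B : (0 < d)%nat ->
  (forall t, (0 < t)%nat -> (d * f t <= p * K ^ t + B)%nat /\ (p * K ^ t <= d * f t + B)%nat) ->
  geometric f (INR p / INR d).
Proof.
intros Hd H. assert (D : 0 < INR d) by now apply lt_0_INR. split.
- exists (Z.of_nat p), (Z.of_nat d). split; [lia|]. now rewrite <- !INR_IZR_INZ.
- exists (INR B / INR d). intros t Ht. destruct (H t Ht) as [H1 H2].
  apply le_INR in H1. apply le_INR in H2.
  rewrite !plus_INR, !mult_INR, !pow_INR in H1, H2.
  replace (_ - _) with ((INR d * INR (f t) - INR p * INR K ^ t) / INR d) by (field; lra).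
  unfold Rdiv. rewrite Rabs_mult, (Rabs_pos_eq (/ INR d)) by (left; now apply Rinv_0_lt_compat).
  apply Rmult_le_compat_r; [left; now apply Rinv_0_lt_compat|].
  apply Rabs_le. lra.
Qed.

Hypothesis K_gt1 : (1 < K)%nat.

Lemma pow_K_unbounded M : exists N, forall t, (N <= t)%nat -> M < INR K ^ t.
Proof.
assert (1 < INR K) by now apply (lt_INR 1).
destruct (Pow_x_infinity (INR K)) with (b := M + 1) as [N HN]; [rewrite Rabs_pos_eq; lra|].
exists N. intros t Ht. specialize (HN t Ht).
rewrite Rabs_pos_eq in HN by (apply pow_le; lra). lra.
Qed.

(** The lower bound on [g] excludes [s <= 0], for which [g] would be bounded; the limit is then
    [r / s]. The shifted index is the one that [gap_start_ge] provides. *)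
Lemma geometric_ratio f g r s : geometric f r -> geometric g s ->
  (forall t, (0 < t)%nat -> (K ^ t <= g (S t))%nat) ->
  exists l, is_rational l /\ Un_cv (fun t => INR (f (S (S t))) / INR (g (S (S t)))) l.
Proof.
intros [Qr [B HB]] [Qs [C HC]] Hg.
assert (K1 : 1 < INR K) by now apply (lt_INR 1).
assert (Kp : forall t, 0 < INR K ^ t) by (intro; apply pow_lt; lra).
assert (HgR : forall t, (0 < t)%nat -> INR K ^ t <= INR (g (S t))).
{ intros t Ht. rewrite <- pow_INR. now apply le_INR, Hg. }
assert (s0 : 0 < s).
{ apply Rnot_le_lt. intro Hs. destruct (pow_K_unbounded C) as [N HN].
  specialize (HN (S N) ltac:(lia)). specialize (HgR (S N) ltac:(lia)).
  specialize (HC (S (S N)) ltac:(lia)). pose proof (RRle_abs (INR (g (S (S N))) - s * INR K ^ S (S N))).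
  assert (s * INR K ^ S (S N) <= 0) by (specialize (Kp (S (S N))); nra). lra. }
exists (r / s). split; [apply rational_div; [assumption|assumption|lra]|].
(* [A] bounds the numerator of [F / H - r / s] over the denominator [H * s]: the main terms cancel
   and only the bounded errors remain. *)
intros eps He. set (A := B * s + Rabs r * C).
destruct (pow_K_unbounded (A / (s * eps))) as [N HN].
exists N. intros t Ht. specialize (HN (S t) ltac:(lia)). specialize (HgR (S t) ltac:(lia)).
specialize (HB (S (S t)) ltac:(lia)). specialize (HC (S (S t)) ltac:(lia)).
specialize (Kp (S t)). set (F := INR (f (S (S t)))) in *. set (H := INR (g (S (S t)))) in *.
set (P := INR K ^ S (S t)) in *.
unfold Rdist. replace (F / H - r / s) with (((F - r * P) * s - r * (H - s * P)) / (H * s)) by (field; lra).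
unfold Rdiv. rewrite Rabs_mult, (Rabs_pos_eq (/ (H * s))) by
  (left; apply Rinv_0_lt_compat, Rmult_lt_0_compat; lra).
assert (HA : Rabs ((F - r * P) * s - r * (H - s * P)) <= A).
{ eapply Rle_trans; [apply Rabs_triang|]. rewrite Rabs_Ropp, !Rabs_mult, (Rabs_pos_eq s) by lra.
  unfold A. pose proof (Rabs_pos r). apply Rplus_le_compat.
  - apply Rmult_le_compat_r; lra.
  - apply Rmult_le_compat_l; lra. }
apply Rmult_lt_reg_r with (H * s); [apply Rmult_lt_0_compat; lra|].
rewrite Rmult_assoc, Rinv_l, Rmult_1_r by (apply Rmult_integral_contrapositive; lra).
eapply Rle_lt_trans; [exact HA|].
apply Rmult_lt_compat_r with (r := s * eps) in HN; [|apply Rmult_lt_0_compat; lra].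
unfold Rdiv in HN. rewrite Rmult_assoc, Rinv_l, Rmult_1_r in HN
  by (apply Rgt_not_eq, Rmult_lt_0_compat; lra).
assert (0 < s * eps) by (apply Rmult_lt_0_compat; lra).
eapply Rlt_le_trans; [exact HN|].
replace (eps * (H * s)) with (H * (s * eps)) by ring. apply Rmult_le_compat_r; lra.
Qed.
End Geometric.

(** * Ratios of linear forms in the powers of a nonnegative integer matrix *)

Module LinearRecurrence.
Import all_boot all_order all_algebra all_field Rstruct.
Set Implicit Arguments.
Unset Strict Implicit.
Unset Printing Implicit Defensive.
Import Order.TTheory GRing.Theory Num.Theory.
Local Open Scope ring_scope.

(** By pigeonhole the orbit has period [j - i] from index [i] on. The chosen [q] is a multiple of
    the period and at least [i], so multiples of [q] all give the same point. *)
Lemma iter_idempotent (T : finType) (f : T -> T) (x : T) :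
  exists2 q, (0 < q)%N & forall t, (0 < t)%N -> iter (q * t) f x = iter q f x.
Proof.
pose F (i : 'I_(#|T|.+1)) := iter i f x.
have [i [j [ij Fij]]] : exists i j : nat, (i < j)%N /\ iter i f x = iter j f x.
  have /injectivePn [i [j ij E]] : ~~ injectiveb F.
    by apply/negP => /injectiveP/leq_card; rewrite card_ord ltnn.
  have : nat_of_ord i != j by [].
  by rewrite neq_ltn => /orP[h|h]; [exists i, j | exists j, i].
have per1 n : (i <= n)%N -> iter (n + (j - i)) f x = iter n f x.
  move=> ni; rewrite -(subnK ni) -addnA subnKC ?(ltnW ij) //.
  by rewrite iterD -Fij -iterD.
have per n k : (i <= n)%N -> iter (n + k * (j - i)) f x = iter n f x.
  move=> ni; elim: k => [|k IH]; first by rewrite addn0.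
  by rewrite mulSnr addnA per1 ?(leq_trans ni) ?leq_addr.
exists (i.+1 * (j - i))%N; first by rewrite muln_gt0 subn_gt0.
case=> // t _; rewrite mulnS [(i.+1 * _ * t)%N]mulnAC.
by rewrite per // (leq_trans (leqnSn i)) // leq_pmulr // subn_gt0.
Qed.

Lemma bernoulli_ler (x : algC) t : 0 <= x -> 1 + x *+ t <= (1 + x) ^+ t.
Proof.
move=> x0; elim: t => [|t IH]; first by rewrite mulr0n addr0 expr0.
rewrite exprS mulrDl mul1r.
have h1 : x <= x * (1 + x) ^+ t.
  by rewrite ler_peMr // exprn_ege1 // lerDl.
by rewrite mulrSr addrA lerD.
Qed.

Lemma expr_unbounded (x C : algC) : 1 < x -> 0 <= C -> exists T, forall t, (T <= t)%N -> C < x ^+ t.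
Proof.
move=> x1 C0; have y0 : 0 < x - 1 by rewrite subr_gt0.
exists (Num.bound (C / (x - 1))) => t Tt.
have hB : C / (x - 1) < t%:R.
  apply: (lt_le_trans (archi_boundP _)); first by rewrite divr_ge0 // ltW.
  by rewrite ler_nat.
rewrite -[x](subrK 1) [_ + 1]addrC.
apply: lt_le_trans (bernoulli_ler t (ltW y0)).
rewrite ltr_pdivrMr // mulr_natl in hB.
by apply: lt_trans hB _; rewrite ltrDr ltr01.
Qed.

Lemma expr_small (q e : algC) : 0 <= q -> q < 1 -> 0 < e ->
  exists T, forall t, (T <= t)%N -> q ^+ t < e.
Proof.
move=> q0 q1 e0; case: (eqVneq q 0) => [->|qn0].
  by exists 1%N => t t1; rewrite expr0n eqn0Ngt t1.
have qp : 0 < q by rewrite lt0r qn0.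
have [||T HT] := @expr_unbounded q^-1 e^-1.
- by rewrite invf_gt1.
- by rewrite invr_ge0 ltW.
exists T => t /HT; rewrite exprVn ltf_pV2 ?posrE ?exprn_gt0 //.
Qed.

Lemma expr_dominated (x y a C : algC) : 0 < y -> y < x -> 0 < a -> 0 <= C ->
  (forall t, a * x ^+ t <= C * y ^+ t) -> False.
Proof.
move=> y0 yx a0 C0 H.
have [||T HT] := @expr_unbounded (x / y) (C / a).
- by rewrite ltr_pdivlMr // mul1r.
- by rewrite divr_ge0 // ltW.
have := HT T (leqnn _); rewrite expr_div_n ltr_pdivrMr // mulrAC ltr_pdivlMr ?exprn_gt0 //.
by move=> h; have := lt_le_trans h (eq_ind _ (fun z => z <= _) (H T) _ (mulrC _ _)); rewrite ltxx.
Qed.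

(** * Growth of matrix powers and dominant eigenvalues *)

Section Spectrum.
Variables (n : nat) (A : 'M[algC]_n.+1).
Implicit Types (w : 'cV[algC]_n.+1) (v : 'rV[algC]_n.+1).

(** Induction on the roots: [(A - l) w] is killed by the shorter product, and
    [A^(t+1) w = l A^t w + A^t (A - l) w]. The strict inequality [|l| < mu] absorbs polynomial
    factors, so multiple roots cause no trouble. *)
Lemma growth_of_roots (s : seq algC) mu w : 0 < mu ->
  all (fun l => `|l| < mu) s ->
  horner_mx A (\prod_(l <- s) ('X - l%:P)) *m w = 0 ->
  exists2 C, 0 <= C & forall t i, `|(A ^+ t *m w) i 0| <= C * mu ^+ t.
Proof.
move=> mu0; elim: s w => [|l s IH] w /=.
  rewrite big_nil rmorph1 mul1mx => _ ->; exists 0 => // t i.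
  by rewrite mulmx0 mxE normr0 mul0r.
case/andP=> lmu smu; rewrite big_cons mulrC rmorphM -mulmxE -mulmxA => /(IH _ smu) [C C0 HC].
have dl : 0 < mu - `|l| by rewrite subr_gt0.
(* The second summand yields [|l| * D + C <= D * mu]; the first covers [t = 0]. *)
pose D := \sum_i `|w i 0| + C / (mu - `|l|).
have D0 : 0 <= \sum_i `|w i 0| by apply: sumr_ge0.
have D1 : 0 <= C / (mu - `|l|) by rewrite divr_ge0 // ltW.
exists D; first by rewrite addr_ge0.
elim=> [|t IHt] i.
  rewrite !expr0 mul1mx mulr1 /D (bigD1 i) //= -addrA lerDl addr_ge0 // sumr_ge0 //.
have -> : A ^+ t.+1 *m w = l *: (A ^+ t *m w) + A ^+ t *m (horner_mx A ('X - l%:P) *m w).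
  rewrite rmorphB /= horner_mx_X horner_mx_C mulmxBl mulmxBr mul_scalar_mx -scalemxAr.
  by rewrite addrC subrK exprSr -mulmxE mulmxA.
rewrite mxE; apply: le_trans (ler_normD _ _) _.
rewrite mxE normrM.
apply: (@le_trans _ _ (`|l| * (D * mu ^+ t) + C * mu ^+ t)).
  by apply: lerD => //; apply: ler_wpM2l.
rewrite mulrA -mulrDl exprS mulrA ler_wpM2r ?exprn_ge0 ?(ltW mu0) //.
rewrite -lerBrDl [D * _]mulrC -mulrBl /D mulrDr [X in _ <= _ + X]mulrC divfK ?gt_eqF //.
by rewrite lerDr mulr_ge0 // ltW.
Qed.

Lemma char_poly_roots : {rs : seq algC | char_poly A = \prod_(l <- rs) ('X - l%:P) & rs != [::]}.
Proof.
have [rs] := closed_field_poly_normal (char_poly A).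
rewrite (monicP (char_poly_monic A)) scale1r => E; exists rs => //.
by apply/eqP => E0; have := size_char_poly A; rewrite E E0 big_nil size_poly1.
Qed.

Lemma root_char_eigen rs l : char_poly A = \prod_(l <- rs) ('X - l%:P) -> l \in rs ->
  exists2 v : 'rV[algC]_n.+1, v *m A = l *: v & v != 0.
Proof.
move=> E lrs; apply/eigenvalueP; rewrite eigenvalue_root_char E.
by rewrite root_prod_XsubC.
Qed.

Lemma max_norm (rs : seq algC) : rs != [::] ->
  exists2 l, l \in rs & {in rs, forall x, `|x| <= `|l|}.
Proof.
elim: rs => // x [|y s] IH _; first by exists x; rewrite ?mem_head // => z; rewrite inE => /eqP->.
have [//|l ls Hl] := IH.
have /orP[xl|lx] := real_leVge (normr_real x) (normr_real l).
  by exists l => [|z]; rewrite in_cons ?ls ?orbT // => /orP[/eqP->//|/Hl].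
exists x => [|z]; rewrite ?mem_head // in_cons => /orP[/eqP->//|/Hl h].
exact: le_trans lx.
Qed.

Hypothesis A_ge0 : forall i j, 0 <= A i j.
Variable K : nat.
Hypothesis A_sub : forall i j, A i j <= (A ^+ 2) i j *+ K.

Lemma Aexp_ge0 t i j : 0 <= (A ^+ t) i j.
Proof.
elim: t i j => [|t IH] i j; first by rewrite expr0 mxE ler0n.
by rewrite exprS -mulmxE mxE sumr_ge0 // => k _; rewrite mulr_ge0.
Qed.

Lemma mulmx_norm_le v (B : 'M[algC]_n.+1) j : (forall i j, 0 <= B i j) ->
  `|(v *m B) 0 j| <= \sum_i `|v 0 i| * B i j.
Proof.
move=> B0; rewrite mxE; apply: le_trans (ler_norm_sum _ _ _) _.
by apply: ler_sum => i _; rewrite normrM (ger0_norm (B0 _ _)).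
Qed.

(* Since K A^2 - A is nonnegative, the modulus |v| of an eigenvector for l satisfies
   K |v| A^2 >= (|K l^2 - l| + |l|) |v|; when |l| is the spectral radius this forces
   equality in the triangle inequality |K l^2 - l| + |l| >= |K l^2|. *)
Lemma dominant_eigen_pos rs l : char_poly A = \prod_(l <- rs) ('X - l%:P) ->
  l \in rs -> {in rs, forall x, `|x| <= `|l|} -> l = `|l|.
Proof.
move=> E lrs lmax; have [v vA vn0] := root_char_eigen E lrs.
have [->|ln0] := eqVneq l 0; first by rewrite normr0.
have th0 : 0 < `|l| by rewrite normr_gt0.
have Kp : (0 < K)%N.
  rewrite lt0n; apply/eqP => K0.
  have A0 : A = 0.
    apply/matrixP=> i j; rewrite [in RHS]mxE; apply/eqP; rewrite eq_le A_ge0 andbT.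
    by have := A_sub i j; rewrite K0 mulr0n.
  move/eqP: vA; rewrite A0 mulmx0 eq_sym scaler_eq0 (negPf ln0) /= => /eqP v0.
  by rewrite v0 eqxx in vn0.
have KR0 : 0 < K%:R :> algC by rewrite ltr0n.
pose sg := `|l ^+ 2 *+ K - l| + `|l|.
have vA2 : v *m A ^+ 2 = l ^+ 2 *: v by rewrite expr2 -mulmxE mulmxA vA -scalemxAl vA scalerA -expr2.
have step j : sg * `|v 0 j| <= (\sum_i `|v 0 i| * (A ^+ 2) i j) *+ K.
  have -> : (\sum_i `|v 0 i| * (A ^+ 2) i j) *+ K =
     \sum_i `|v 0 i| * ((A ^+ 2) *+ K - A) i j + \sum_i `|v 0 i| * A i j.
    rewrite -big_split -sumrMnl; apply: eq_bigr => i _ /=.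
    have -> : (A ^+ 2 *+ K - A) i j = (A ^+ 2) i j *+ K - A i j.
      by rewrite -mulmxnE 2!mxE; congr (_ + _); rewrite mxE.
    by rewrite -mulrDr subrK mulrnAr.
  rewrite mulrDl; apply: lerD.
    rewrite -normrM.
    have -> : (l ^+ 2 *+ K - l) * v 0 j = (v *m (A ^+ 2 *+ K - A)) 0 j.
      by rewrite mulmxBr -scaler_nat -scalemxAr vA2 vA !mxE mulrBl mulrA mulr_natl.
    apply: mulmx_norm_le => i k; rewrite !mxE mulmxnE subr_ge0; exact: A_sub.
  by rewrite -normrM; have := mulmx_norm_le v j A_ge0; rewrite vA !mxE.
have [j vj] : exists j, v 0 j != 0.
  by apply/existsP; apply: contraNT vn0; rewrite negb_exists => /forallP h;
     apply/eqP/rowP=> j; rewrite !mxE; apply/eqP; have := h j; rewrite negbK.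
have vj0 : 0 < `|v 0 j| by rewrite normr_gt0.
have sgle : `|l| ^+ 2 *+ K <= sg.
  by rewrite -normrX -normrMn /sg -{1}[l ^+ 2 *+ K](subrK l); exact: ler_normD.
(* In the equality case both summands are nonnegative multiples of one unit [u], as is their sum
   [K l^2]. Comparing with [l = |l| u] gives [u^2 = u], hence [u = 1]. *)
have [sgE|sgN] := eqVneq (`|l| ^+ 2 *+ K) sg.
  have := normCDeq (x := l ^+ 2 *+ K - l) (y := l).
  rewrite subrK normrMn normrX sgE => /(_ erefl) [u u1 [E1 E2]].
  have : l ^+ 2 *+ K = (`|l| ^+ 2 *+ K) * u.
    by rewrite sgE mulrDl -E1 -E2 subrK.
  rewrite {1}E2 exprMn -!mulrnAl => /eqP.
  rewrite -subr_eq0 -mulrBr mulf_eq0 expr2 mulrnAl -mulr_natl !mulf_eq0.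
  rewrite (gt_eqF KR0) (gt_eqF th0) /= => /eqP/subr0_eq uu.
  have un0 : u != 0 by rewrite -normr_gt0 (eqP u1) ltr01.
  by move: uu; rewrite -[RHS]mulr1 => /(mulfI un0) u1'; rewrite E2 u1' mulr1 normr_id.
(* In the strict case [eta > |l|^2], and iterating [step] makes some entry of [A^(2t)] grow at least
   like [eta^t]. But [growth_of_roots] bounds these entries by a multiple of [nu^t] with
   [|l|^2 < nu < eta]. *)
exfalso.
have sglt : `|l| ^+ 2 *+ K < sg by rewrite lt_neqAle sgN.
pose eta := sg / K%:R.
have etalt : `|l| ^+ 2 < eta by rewrite ltr_pdivlMr // mulr_natr.
have eta0 : 0 < eta by apply: le_lt_trans etalt; rewrite exprn_ge0.
have step' k : eta * `|v 0 k| <= \sum_i `|v 0 i| * (A ^+ 2) i k.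
  by rewrite mulrAC ler_pdivrMr // mulr_natr.
have iterv t k : eta ^+ t * `|v 0 k| <= \sum_i `|v 0 i| * (A ^+ (2 * t)) i k.
  elim: t k => [|t IH] k.
    rewrite muln0 !expr0 mul1r (bigD1 k) //= mxE eqxx mulr1 lerDl sumr_ge0 // => i ik.
    by rewrite mxE mulr_ge0 ?ler0n.
  rewrite mulnS exprD exprSr -mulrA.
  apply: (@le_trans _ _ (\sum_i (eta ^+ t * `|v 0 i|) * (A ^+ 2) i k)).
    apply: le_trans (ler_wpM2l _ (step' k)) _; first by rewrite exprn_ge0 // ltW.
    by rewrite mulr_sumr; apply: ler_sum => i _; rewrite mulrA.
  apply: (@le_trans _ _ (\sum_i (\sum_h `|v 0 h| * (A ^+ (2 * t)) h i) * (A ^+ 2) i k)).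
    by apply: ler_sum => i _; rewrite ler_wpM2r // Aexp_ge0.
  rewrite le_eqVlt; apply/orP; left; apply/eqP.
  under eq_bigr do rewrite mulr_suml.
  rewrite exchange_big /=; apply: eq_bigr => h _.
  rewrite -exprD addnC exprD -mulmxE mxE mulr_sumr; apply: eq_bigr => i _.
  by rewrite mulrA.
pose nu := (`|l| ^+ 2 + eta) / 2%:R.
have l2nu : `|l| ^+ 2 < nu by rewrite /nu midf_lt.
have nueta : nu < eta by rewrite /nu midf_lt.
have nu0 : 0 < nu by apply: le_lt_trans l2nu; rewrite exprn_ge0.
have mu0 : 0 < sqrtC nu by rewrite sqrtC_gt0.
have allmu : all (fun l => `|l| < sqrtC nu) rs.
  apply/allP => x /lmax xl; apply: le_lt_trans xl _.
  by rewrite -(@ltr_pXn2r _ 2) ?nnegrE ?(ltW mu0) // sqrtCK.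
have [|C C0 HC] := growth_of_roots (w := delta_mx j 0) mu0 allmu.
  by rewrite -E Cayley_Hamilton mul0mx.
apply: (@expr_dominated eta nu `|v 0 j| ((\sum_i `|v 0 i|) * C)) => //.
  by rewrite mulr_ge0 // sumr_ge0.
move=> t; rewrite mulrC; apply: le_trans (iterv t j) _.
rewrite -mulrA mulr_suml; apply: ler_sum => i _; apply: ler_wpM2l => //.
have := HC (2 * t)%N i; rewrite [sqrtC nu ^+ _]exprM sqrtCK.
rewrite -colE mxE => h; apply: le_trans h; exact: real_ler_norm (ger0_real (Aexp_ge0 _ _ _)).
Qed.

End Spectrum.

Lemma strict_norm_bound (s : seq algC) th : 0 < th -> all (fun l => `|l| < th) s ->
  exists2 mu, 0 < mu < th & all (fun l => `|l| < mu) s.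
Proof.
move=> th0; elim: s => [_|x s IH] /=.
  by exists (th / 2%:R); rewrite // divr_gt0 // ltr_pdivrMr // ltr_pMr // ltr1n.
case/andP=> xth /IH [mu /andP[mu0 muth] smu].
pose nu := (`|x| + th) / 2%:R.
have xnu : `|x| < nu by rewrite /nu midf_lt.
have nuth : nu < th by rewrite /nu midf_lt.
have nu0 : 0 < nu by apply: le_lt_trans xnu.
have /orP[h|h] := real_leVge (gtr0_real mu0) (gtr0_real nu0).
  by exists nu; rewrite ?nu0 //= xnu /=; apply: sub_all smu => y yl; exact: lt_le_trans h.
by exists mu; rewrite ?mu0 //= smu andbT; exact: lt_le_trans h.
Qed.

(** * Matrix orbits as exponential polynomials plus a smaller error *)

Section Decomposition.
Variables (n : nat) (A : 'M[algC]_n.+1).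
Implicit Types (w : 'cV[algC]_n.+1).

(** Binomial expansion of [(th + B)^t] with [B = A - th], cut off at [K] because [B^K] kills [w]. *)
Lemma exp_generalized_eigen th K w : th != 0 -> (A - th%:M) ^+ K *m w = 0 ->
  forall t, A ^+ t *m w =
    th ^+ t *: \sum_(j < K) 'C(t, j)%:R *: (th ^- j *: ((A - th%:M) ^+ j *m w)).
Proof.
move=> th0 Kw t; set B := A - th%:M in Kw *.
have Bw j : (K <= j)%N -> B ^+ j *m w = 0.
  by move=> Kj; rewrite -(subnK Kj) exprD -mulmxE -mulmxA Kw mulmx0.
have -> : A = th%:M + B by rewrite addrC subrK.
have cB : GRing.comm th%:M B by rewrite /GRing.comm -!mulmxE scalar_mxC.
rewrite (exprDn_comm _ cB) mulmx_suml scaler_sumr.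
pose F j := th ^+ t *: ('C(t, j)%:R *: (th ^- j *: (B ^+ j *m w))).
(* Both sums extend to the common range [t.+1 + K]: the binomials vanish beyond [t], the vectors
   [B^j w] from [K] on. This avoids comparing [t] with [K]. *)
transitivity (\sum_(j < t.+1 + K) F j).
  rewrite big_split_ord /= [X in _ + X]big1 ?addr0 => [|i _]; last first.
    by rewrite /F bin_small ?scale0r ?scaler0 // leq_addr.
  apply: eq_bigr => i _; rewrite /F -(rmorphXn (scalar_mx (n := n.+1))) /= -mulmxE.
  rewrite -scaler_nat -scalemxAl mul_scalar_mx -scalemxAl !scalerA.
  have it : (i <= t)%N by rewrite -ltnS.
  have -> : th ^+ t = th ^+ (t - i) * th ^+ i by rewrite -exprD subnK.
  by congr (_ *: _); rewrite mulrA -mulrA mulrACA mulfV ?expf_neq0 // mulr1 mulrC.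
rewrite addnC big_split_ord /= [X in _ + X]big1 ?addr0 // => i _.
by rewrite /F Bw ?scaler0 // leq_addr.
Qed.

(** The characteristic polynomial is [p * e^K] with [e = X - th] and all roots of [p] of modulus
    below [mu]. A Bezout relation splits [w] into [w1], killed by [e^K], which gives the exact main
    term, and [w2], killed by [p], which gives the error. [K] and [mu] do not depend on [w]. *)
Lemma exp_poly_decomposition rs th :
  char_poly A = \prod_(l <- rs) ('X - l%:P) -> 0 < th ->
  {in rs, forall x, `|x| <= th} -> {in rs, forall x, `|x| = th -> x = th} ->
  exists K mu, 0 < mu < th /\ forall w, exists (q : nat -> 'cV[algC]_n.+1) (C : algC),
    0 <= C /\ forall t i,
     `|(A ^+ t *m w) i 0 - th ^+ t * \sum_(j < K) q j i 0 * 'C(t, j)%:R| <= C * mu ^+ t.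
Proof.
move=> E th0 le_th eq_th; have thn0 := lt0r_neq0 th0.
pose s := [seq x <- rs | x != th].
have sth : all (fun x => `|x| < th) s.
  apply/allP=> x; rewrite mem_filter => /andP[xth xrs].
  by rewrite lt_neqAle le_th // andbT; apply: contra xth => /eqP/eq_th->.
have [mu muth smu] := strict_norm_bound th0 sth; have /andP[mu0 _] := muth.
pose K := count (pred1 th) rs.
pose p := \prod_(l <- s) ('X - l%:P); pose e := ('X - th%:P) : {poly algC}.
have Ep : char_poly A = p * e ^+ K.
  rewrite E (bigID (fun x => x != th)) /= -big_filter; congr (_ * _).
  rewrite (eq_bigl (pred1 th)) => [|x]; last by rewrite negbK.
  rewrite -big_filter (eq_big_seq (fun=> e)) => [|x]; last first.
    by rewrite mem_filter => /andP[/eqP-> _].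
  by rewrite big_const_seq count_predT size_filter -/K; elim: (K) => //= k ->; rewrite exprS.
have cop : coprimep p (e ^+ K).
  apply: coprimep_expr; rewrite coprimep_XsubC root_prod_XsubC mem_filter eqxx //.
have /Bezout_eq1_coprimepP [[u v] /= uv] := cop.
exists K, mu; split=> // w.
pose w1 := horner_mx A (u * p) *m w; pose w2 := horner_mx A (v * e ^+ K) *m w.
have w12 : w = w1 + w2 by rewrite -mulmxDl -rmorphD /= uv rmorph1 mul1mx.
have he : horner_mx A e = A - th%:M by rewrite /e rmorphB /= horner_mx_X horner_mx_C.
have kw1 : (A - th%:M) ^+ K *m w1 = 0.
  rewrite -he -rmorphXn /= mulmxA mulmxE -rmorphM /= mulrCA [_ * p]mulrC -Ep.
  by rewrite rmorphM /= Cayley_Hamilton mulr0 mul0mx.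
have kw2 : horner_mx A p *m w2 = 0.
  by rewrite mulmxA mulmxE -rmorphM /= mulrCA -Ep rmorphM /= Cayley_Hamilton mulr0 mul0mx.
have [C C0 HC] := growth_of_roots mu0 smu kw2.
pose q j := th ^- j *: ((A - th%:M) ^+ j *m w1); exists q, C; split=> // t i.
have -> : (A ^+ t *m w) i 0 = th ^+ t * \sum_(j < K) q j i 0 * 'C(t, j)%:R + (A ^+ t *m w2) i 0.
  rewrite {1}w12 mulmxDr mxE (exp_generalized_eigen thn0 kw1) mxE summxE; congr (_ * _ + _).
  by apply: eq_bigr => j _; rewrite mxE mulrC.
by rewrite addrAC subrr add0r.
Qed.
End Decomposition.

(** * Leading terms and ratios of exponential polynomials *)

Section PolyExp.
Variables (th mu : algC) (K : nat).
Hypotheses (mu0 : 0 < mu) (muth : mu < th).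

Let th0 : 0 < th := lt_trans mu0 muth.

Definition polyexp (f : nat -> algC) (q : nat -> algC) := exists2 C, 0 <= C & forall t,
  `|f t - th ^+ t * \sum_(j < K) q j * 'C(t, j)%:R| <= C * mu ^+ t.

(** Asymptotically [f t = (c + o(1)) th^t 'C(t, m)]. The value [c = 0] is allowed, so
    [leading m 0 f] expresses negligibility. *)
Definition leading (m : nat) (c : algC) (f : nat -> algC) :=
  forall e, 0 < e -> exists T, forall t, (T <= t)%N ->
    `|f t - c * (th ^+ t * 'C(t, m)%:R)| <= e * (th ^+ t * 'C(t, m)%:R).

Lemma leadingD m c d f g : leading m c f -> leading m d g ->
  leading m (c + d) (fun t => f t + g t).
Proof.
move=> Hf Hg e e0; have e2 : 0 < e / 2%:R by rewrite divr_gt0.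
have [T1 H1] := Hf _ e2; have [T2 H2] := Hg _ e2.
exists (maxn T1 T2) => t; rewrite geq_max => /andP[/H1 h1 /H2 h2].
rewrite mulrDl opprD addrACA; apply: le_trans (ler_normD _ _) _.
by rewrite [e]splitr mulrDl lerD.
Qed.

Lemma leadingZ m c a f : leading m c f -> leading m (a * c) (fun t => a * f t).
Proof.
move=> Hf e e0; have a0 : 0 < `|a| + 1 by rewrite ltr_wpDl.
have [T HT] := Hf _ (divr_gt0 e0 a0); exists T => t /HT h.
rewrite -mulrA -mulrBr normrM.
apply: le_trans (_ : (`|a| + 1) * (e / (`|a| + 1) * (th ^+ t * 'C(t, m)%:R)) <= _).
  by apply: ler_pM => //; rewrite lerDl.
by rewrite mulrA [_ * (e / _)]mulrC divfK ?gt_eqF.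
Qed.

(** The identity [m.+1 * 'C(t, m.+1) = (t - m) * 'C(t, m)] makes each binomial negligible against
    the next. *)
Lemma binomial_negligible j m : (j < m)%N -> forall e : algC, 0 < e -> exists T, forall t,
  (T <= t)%N -> 'C(t, j)%:R <= e * 'C(t, m)%:R.
Proof.
elim: m => // m IH; rewrite ltnS leq_eqVlt => jm e e0.
have [T1 HT1] : exists T, forall t, (T <= t)%N -> 'C(t, m)%:R <= e * 'C(t, m.+1)%:R.
  exists (Num.bound (m.+1%:R / e) + m)%N => t Tt.
  have h := mul_bin_left t m.
  have mt : (m <= t)%N by apply: leq_trans Tt; rewrite leq_addl.
  have b : m.+1%:R / e <= (t - m)%:R.
    apply: le_trans (ltW (archi_boundP _)) _; first by rewrite divr_ge0 // ltW.
    by rewrite ler_nat leq_subRL // addnC.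
  rewrite -(ler_pM2l (ltr0Sn _ m)) mulrCA -[m.+1%:R * 'C(t, m.+1)%:R]natrM h natrM mulrA ler_wpM2r //.
  by rewrite mulrC -ler_pdivrMr.
case/orP: jm => [/eqP->|jm]; first by exists T1.
have [T2 HT2] := IH jm _ ltr01.
exists (maxn T1 T2) => t; rewrite geq_max => /andP[/HT1 h1 /HT2 h2].
by apply: le_trans h1; rewrite mul1r in h2.
Qed.

Lemma leading_le m f g C a : 0 <= C -> leading m 0 f -> 
  (exists T, forall t, (T <= t)%N -> `|g t - a * (th ^+ t * 'C(t, m)%:R)| <= C * `|f t|) ->
  leading m a g.
Proof.
move=> C0 Hf [T1 H1] e e0; have c0 : 0 < C + 1 by rewrite ltr_wpDl.
have [T2 H2] := Hf _ (divr_gt0 e0 c0).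
exists (maxn T1 T2) => t; rewrite geq_max => /andP[/H1 h1 /H2].
rewrite mul0r subr0 => h2; apply: le_trans h1 _.
apply: le_trans (_ : (C + 1) * (e / (C + 1) * (th ^+ t * 'C(t, m)%:R)) <= _).
  by apply: ler_pM => //; rewrite lerDl.
by rewrite mulrA [_ * (e / _)]mulrC divfK ?gt_eqF.
Qed.

Lemma leading_exp_small m : leading m 0 (fun t => mu ^+ t).
Proof.
move=> e e0; have [||T HT] := @expr_small (mu / th) e _ _ e0.
- by rewrite divr_ge0 // ltW.
- by rewrite ltr_pdivrMr // mul1r.
exists (maxn T m) => t; rewrite geq_max => /andP[/HT h mt].
rewrite mul0r subr0 ger0_norm ?exprn_ge0 ?(ltW mu0) //.
rewrite mulrCA mulrC -ler_pdivrMr ?exprn_gt0 // -expr_div_n.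
apply: le_trans (ltW h) _; rewrite ler_peMr ?(ltW e0) //.
by rewrite ler1n bin_gt0.
Qed.

Lemma leading_bin j m : (j < m)%N -> leading m 0 (fun t => th ^+ t * 'C(t, j)%:R).
Proof.
move=> jm e e0; have [T HT] := binomial_negligible jm e0; exists T => t /HT h.
rewrite mul0r subr0 ger0_norm ?mulr_ge0 ?exprn_ge0 ?(ltW th0) ?ler0n //.
by rewrite mulrCA ler_wpM2l // exprn_ge0 // ltW.
Qed.

Lemma leading_sum m (r : seq nat) (F : nat -> nat -> algC) :
  (forall j, j \in r -> leading m 0 (F j)) -> leading m 0 (fun t => \sum_(j <- r) F j t).
Proof.
elim: r => [|j r IH] Hr.
  by move=> e e0; exists 0%N => t _; rewrite big_nil mul0r subr0 normr0 mulr_ge0 ?mulr_ge0 ?exprn_ge0 ?ler0n ?ltW.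
have h1 := Hr j (mem_head _ _).
have {}IH := IH (fun i ir => Hr i (@mem_behead _ (j :: r) i ir)).
have := leadingD h1 IH; rewrite addr0 => H e /H [T HT]; exists T => t /HT.
by rewrite big_cons.
Qed.

(** Here [q m] may be zero, so that a single [m] can serve all sequences in [ratio_converges]. *)
Lemma polyexp_leading f q m : polyexp f q -> (m < K)%N ->
  (forall j, (m < j < K)%N -> q j = 0) -> leading m (q m) f.
Proof.
move=> [C C0 HC] mK qj.
have Hsm : leading m 0 (fun t => f t - th ^+ t * \sum_(j < K) q j * 'C(t, j)%:R).
  apply: (leading_le C0 (leading_exp_small m)); exists 0%N => t _.
  by rewrite mul0r subr0 (ger0_norm (exprn_ge0 _ (ltW mu0))).
have Hlow : leading m 0 (fun t => \sum_(j <- iota 0 m) q j * (th ^+ t * 'C(t, j)%:R)).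
  apply: (@leading_sum m _ (fun j t => q j * (th ^+ t * 'C(t, j)%:R))) => j.
  by rewrite mem_iota add0n => /andP[_ jm]; rewrite -(mulr0 (q j)); apply: leadingZ; exact: leading_bin.
have := leadingD Hsm Hlow; rewrite addr0 => H e /H [T HT]; exists T => t /HT.
congr (`|_| <= _); rewrite mul0r subr0 -addrA; congr (_ + _).
have -> : \sum_(j < K) q j * 'C(t, j)%:R = \sum_(0 <= j < m) q j * 'C(t, j)%:R + q m * 'C(t, m)%:R.
  rewrite -(big_mkord predT (fun j => q j * 'C(t, j)%:R)) (@big_cat_nat _ _ _ m) //=; last exact: ltnW.
  congr (_ + _); rewrite big_ltn // big_nat big1 ?addr0 // => j h.
  by rewrite qj // mul0r.
rewrite /index_iota subn0 mulrDr opprD mulr_sumr.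
under [X in _ + X]eq_bigr do rewrite mulrCA.
by rewrite addrAC addNr add0r mulrCA.
Qed.

Lemma leading_dominated m c C f g : 0 <= C -> leading m c f -> leading m 0 g ->
  (forall t, `|f t| <= C * `|g t|) -> c = 0.
Proof.
move=> C0 Hf Hg fg; apply/eqP; case: eqVneq => // c0; exfalso.
have H0 : leading m 0 f.
  by apply: (leading_le C0 Hg); exists 0%N => t _; rewrite mul0r subr0.
have nc0 : 0 < `|c| / 2%:R / 2%:R by rewrite !divr_gt0 ?normr_gt0.
have [T1 H1] := Hf _ nc0; have [T2 H2] := H0 _ nc0.
pose t := maxn (maxn T1 T2) m.
have t1 : (T1 <= t)%N by rewrite /t !leq_max leqnn.
have t2 : (T2 <= t)%N by rewrite /t !leq_max leqnn orbT.
have mt : (m <= t)%N by rewrite leq_maxr.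
have := lerD (H1 t t1) (H2 t t2).
set b := th ^+ t * _; rewrite mul0r subr0 -mulrDl => h.
have b0 : 0 < b by rewrite mulr_gt0 ?exprn_gt0 // ltr0n bin_gt0.
have h' := le_trans (ler_normB (f t - c * b) (f t)) h.
move: h'; rewrite addrAC subrr add0r normrN normrM (gtr0_norm b0) ler_pM2r //.
by rewrite -splitr ler_pdivlMr // ger_pMr ?normr_gt0 // lern1.
Qed.

(** The sequence [a] is the yardstick. Not being [O(mu^t)], it has a top nonzero coefficient, of
    index [m]. Domination by [a] kills the coefficients of [num] and [den] above [m], and
    [a <= C * den] makes [qd m] nonzero. The limit is [qn m / qd m]. *)
Lemma ratio_converges a num den qa qn qd C :
  polyexp a qa -> polyexp num qn -> polyexp den qd -> 0 <= C ->
  (forall t, 0 <= a t) -> (forall t, 0 <= den t) ->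
  (forall t, `|num t| <= C * a t) -> (forall t, den t <= C * a t) ->
  (forall t, a t <= C * den t) ->
  (forall D, 0 <= D -> ~ forall t, a t <= D * mu ^+ t) ->
  exists L, forall e, 0 < e -> exists T, forall t, (T <= t)%N ->
    `|num t - L * den t| <= e * den t.
Proof.
move=> pa pn pd C0 a0 den0 numa dena aden abig.
have top (q : nat -> algC) : (forall j, (j < K)%N -> q j = 0) \/
   exists2 m, (m < K)%N /\ q m != 0 & forall j, (m < j < K)%N -> q j = 0.
  have [/existsP|/existsPn h] := boolP [exists j : 'I_K, q j != 0]; last first.
    by left=> j jK; apply/eqP; have := h (Ordinal jK); rewrite negbK.
  case=> j qj; right.
  have ex : exists j, (j < K)%N && (q j != 0) by exists j; rewrite ltn_ord.
  have bnd i : (i < K)%N && (q i != 0) -> (i <= K)%N by case/andP=> /ltnW.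
  have [m /andP[mK qm] mmax] := ex_maxnP ex bnd.
  exists m => // i /andP[mi iK]; apply/eqP; apply/idPn => qi.
  by have := mmax i; rewrite iK qi leqNgt mi => /(_ isT).
have [qa0|[m [mK qm] mmax]] := top qa.
  case: pa => D D0 HD; case: (abig D D0) => t; have := HD t.
  by rewrite big1 ?mulr0 ?subr0 ?ger0_norm // => j _; rewrite qa0 // mul0r.
have la := polyexp_leading pa mK mmax.
have lower g qg : polyexp g qg -> (forall t, `|g t| <= C * a t) -> leading m (qg m) g.
  move=> pg ga; apply: polyexp_leading => // j /andP[mj jK].
  have [->//|[m' [mK' qm'] mmax']] := top qg.
  have [m'm|mm'] := leqP m' m; first by apply: mmax'; rewrite jK (leq_ltn_trans m'm).
  exfalso; move/eqP: qm'; apply.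
  have l0 : leading m' 0 a.
    rewrite -(mmax m') ?mm' //; apply: polyexp_leading => // i /andP[h iK].
    by rewrite mmax // iK (ltn_trans mm').
  apply: (leading_dominated C0 (polyexp_leading pg mK' mmax') l0) => t.
  by rewrite (ger0_norm (a0 t)).
have ln := lower _ _ pn numa.
have ld : leading m (qd m) den by apply: lower pd _ => t; rewrite ger0_norm.
have qd0 : qd m != 0.
  apply: contra_neq qm => qd0; rewrite qd0 in ld.
  by apply: (leading_dominated C0 la ld) => t; rewrite !ger0_norm.
exists (qn m / qd m) => e e0.
have l0 : leading m 0 (fun t => num t - qn m / qd m * den t).
  have := leadingD ln (leadingZ (- (qn m / qd m)) ld).
  rewrite mulNr divfK // subrr => H e1 /H [T HT]; exists T => t /HT; by rewrite mulNr.
(* From [T1] on, [den t] is at least half of its leading term, which turns the error into a multiple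
   of [den t]. *)
have d2 : 0 < `|qd m| / 2%:R by rewrite divr_gt0 ?normr_gt0.
have [T1 H1] := ld _ d2.
have [T2 H2] := l0 _ (mulr_gt0 e0 d2).
exists (maxn T1 T2) => t; rewrite geq_max => /andP[/H1 h1 /H2].
rewrite mul0r subr0 => h2; apply: le_trans h2 _; rewrite -mulrA ler_wpM2l ?(ltW e0) //.
set b := th ^+ t * _ in h1 *.
have b0 : 0 <= b by rewrite mulr_ge0 ?exprn_ge0 ?ler0n ?(ltW th0).
have := ler_normB (den t) (den t - qd m * b).
rewrite opprB addrCA subrr addr0 normrM (ger0_norm b0) (ger0_norm (den0 t)) => h3.
have := le_trans h3 (lerD (lexx _) h1).
by rewrite -lerBlDr -mulrBl {1}[`|qd m|]splitr addrK.
Qed.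
End PolyExp.

(** Coefficients are integers because the start of a run is a difference of lengths. *)
Definition linear_form (J : finType) (X : nat -> J -> nat) (f : nat -> nat) :=
  exists al : J -> int, forall t, (f t)%:Z = \sum_j al j * (X t j)%:Z.

(** * Linear forms along the orbit of a nonnegative integer matrix *)

Section Ratio.
Variables (n : nat) (M : 'I_n.+1 -> 'I_n.+1 -> nat) (X Y : nat -> 'I_n.+1 -> nat).
Variables (a : 'I_n.+1) (C : nat).
Hypothesis X_rec : forall t i, X t.+1 i = (\sum_j M i j * X t j)%N.
(** Coordinates of [X] may vanish, so the orbit itself does not bound the powers of [M]. The
    auxiliary [Y], positive at the start and satisfying the recurrence only as an inequality, does
    so, and through [Y_le] the coordinate [X t a] dominates these powers. *)
Hypothesis Y0_gt0 : forall i, (0 < Y 0 i)%N.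
Hypothesis Y_super : forall t i, (\sum_j M i j * Y t j <= Y t.+1 i)%N.
Hypothesis Y_le : forall t i, (Y t i <= C * X t a)%N.
Hypothesis X_mono : forall t, (X t a <= X t.+1 a)%N.
Hypothesis X0_gt0 : (0 < X 0 a)%N.

Local Notation linform := (linear_form X).

Let m : 'M[algC]_n.+1 := \matrix_(i, j) (M i j)%:R.
Let xcol s : 'cV[algC]_n.+1 := \col_i (X s i)%:R.

Lemma state_exp t s : m ^+ t *m xcol s = xcol (t + s).
Proof.
elim: t s => [|t IH] s; first by rewrite expr0 mul1mx.
rewrite exprSr -mulmxE -mulmxA addSnnS -IH; congr (_ *m _).
apply/matrixP=> i j; rewrite !mxE X_rec natr_sum; apply: eq_bigr => h _.
by rewrite !mxE natrM.
Qed.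

Lemma X_bounded : exists D : nat, forall t i, (X t i <= D * X t a)%N.
Proof.
pose D := (\sum_i X 0 i)%N.
exists (D * C)%N => t i.
suff h : (X t i <= D * Y t i)%N by apply: leq_trans h _; rewrite -mulnA leq_mul2l Y_le orbT.
elim: t i => [|t IH] i.
  by apply: leq_trans (leq_pmulr _ (Y0_gt0 i)); rewrite /D (bigD1 i) //= leq_addr.
rewrite X_rec; apply: leq_trans (leq_mul (leqnn D) (Y_super t i)).
by rewrite big_distrr /=; apply: leq_sum => j _; rewrite mulnCA leq_mul2l IH orbT.
Qed.

Lemma X_gt0 t : (0 < X t a)%N.
Proof. by elim: t => // t IH; apply: leq_trans (X_mono t). Qed.

Lemma X_le s t : (X t a <= X (t + s) a)%N.
Proof. by elim: s => [|s IH]; rewrite ?addn0 // addnS (leq_trans IH). Qed.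

Lemma m_ge0 t i j : 0 <= (m ^+ t) i j.
Proof. by apply: Aexp_ge0 => h k; rewrite mxE ler0n. Qed.

Lemma m_le t i j : (m ^+ t) i j <= (C * X t a)%:R.
Proof.
suff h : \sum_k (m ^+ t) i k * (Y 0 k)%:R <= (Y t i)%:R.
  apply: le_trans (_ : (Y t i)%:R <= _); last by rewrite ler_nat.
  apply: le_trans h; rewrite (bigD1 j) //= -[X in X <= _]addr0 lerD //.
    by rewrite ler_peMr ?m_ge0 // ler1n.
  by apply: sumr_ge0 => k _; rewrite mulr_ge0 ?m_ge0 ?ler0n.
elim: t i => [|t IH] i.
  rewrite expr0 (bigD1 i) //= mxE eqxx mul1r big1 ?addr0 // => k ki.
  by rewrite mxE eq_sym (negPf ki) mul0r.
rewrite exprS.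
apply: le_trans (_ : (\sum_k M i k * Y t k)%:R <= _); last by rewrite ler_nat Y_super.
apply: (@le_trans _ _ (\sum_k (M i k)%:R * \sum_l (m ^+ t) k l * (Y 0 l)%:R)).
  rewrite le_eqVlt; apply/orP; left; apply/eqP.
  under eq_bigr do rewrite -mulmxE mxE mulr_suml.
  rewrite exchange_big /=; apply: eq_bigr => k _; rewrite mulr_sumr.
  by apply: eq_bigr => l _; rewrite !mxE mulrA.
rewrite natr_sum; apply: ler_sum => k _; rewrite natrM ler_wpM2l ?ler0n //.
Qed.

(* Along multiples of q the zero pattern of m^t is constant, so every entry of
   m^q is controlled by the corresponding entry of m^2q. *)
Lemma idempotent_pattern : exists2 q, (0 < q)%N & exists K,
  forall i j, (m ^+ q) i j <= ((m ^+ q) ^+ 2) i j *+ K.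
Proof.
pose pat (B : 'M[algC]_n.+1) : {ffun 'I_n.+1 * 'I_n.+1 -> bool} := [ffun p => B p.1 p.2 != 0].
(* [F] is the effect of left multiplication by [m] on zero patterns; nonnegative entries cannot
   cancel. *)
pose F (P : {ffun 'I_n.+1 * 'I_n.+1 -> bool}) : {ffun 'I_n.+1 * 'I_n.+1 -> bool} :=
  [ffun p => [exists h, (M p.1 h != 0)%N && P (h, p.2)]].
have pF t : pat (m ^+ t) = iter t F (pat 1).
  elim: t => [|t IH]; first by rewrite expr0.
  rewrite iterS -IH; apply/ffunP=> -[i j]; rewrite !ffunE /= exprS -mulmxE mxE.
  rewrite psumr_eq0 => [|h _]; last by rewrite mulr_ge0 ?m_ge0 // mxE ler0n.
  rewrite -has_predC; apply/hasP/existsP => [[h _ /= hh]|[h hh]]; exists h.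
  - by move: hh; rewrite ffunE /= !mxE mulf_eq0 negb_or pnatr_eq0.
  - by rewrite mem_index_enum.
  - by move: hh; rewrite ffunE /= !mxE mulf_eq0 negb_or pnatr_eq0.
have [q q0 Hq] := iter_idempotent F (pat 1).
exists q => //.
have nat_m t i j : exists k : nat, (m ^+ t) i j = k%:R.
  elim: t i j => [|t IH] i j; first by exists (i == j); rewrite expr0 mxE.
  have : forall h, exists k : nat, m i h * (m ^+ t) h j = k%:R.
    by move=> h; have [k kE] := IH h j; exists (M i h * k)%N; rewrite mxE kE natrM.
  rewrite exprS -mulmxE mxE; elim: (index_enum _) => [|h r IHr] H.
    by exists 0%N; rewrite big_nil.
  have [k1 E1] := H h; have [k2 E2] := IHr H.
  by exists (k1 + k2)%N; rewrite big_cons E1 E2 natrD.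
(* A nonzero entry of the square is a natural number, hence at least [1], while [m_le] bounds every
   entry of [m ^+ q]. *)
exists (C * X q a)%N => i j; rewrite -exprM.
have := Hq 2 isT; rewrite -!pF => /ffunP /(_ (i, j)); rewrite !ffunE /=.
have [k1 E1] := nat_m q i j; have [k2 E2] := nat_m (q * 2)%N i j.
have := m_le q i j; rewrite E1 E2 -mulrnA !ler_nat !pnatr_eq0.
case: k2 {E2} => [|k2] h; first by case: (k1) => //.
by move=> _; apply: leq_trans h _; rewrite leq_pmull.
Qed.

(** By [idempotent_pattern], [A = m ^+ q] satisfies the hypotheses of [dominant_eigen_pos], so its
    only eigenvalue of maximal modulus is a positive [l]. Linear forms along [q * t + s] are then
    exponential polynomials up to a smaller error, compared by [ratio_converges] with [X t a] as
    yardstick. *)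
Theorem linform_ratio : exists2 q, (0 < q)%N & forall s num den C',
  linform num -> linform den -> (forall t, X t a <= C' * den t)%N ->
  exists L : algC, forall e, 0 < e -> exists T, forall t, (T <= t)%N ->
    `|(num (q * t + s)%N)%:R - L * (den (q * t + s)%N)%:R| <= e * (den (q * t + s)%N)%:R.
Proof.
have [q q0 [K HK]] := idempotent_pattern; exists q => // s num den C' lnum lden aden.
pose A := m ^+ q.
have A0 i j : 0 <= A i j by apply: m_ge0.
have [rs E rs0] := char_poly_roots A.
have [l lrs lmax] := max_norm rs0.
have lE := dominant_eigen_pos A0 HK E lrs lmax.
have AE t : A ^+ t *m xcol s = xcol (q * t + s) by rewrite -exprM state_exp.
have [v vA vn0] := root_char_eigen E lrs.
(* If [l = 0], all eigenvalues vanish and [A] is nilpotent, but coordinate [a] stays positive along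
   the orbit. *)
have l0 : 0 < l.
  have l_ge0 : 0 <= l by rewrite lE.
  rewrite lt_def l_ge0 andbT; apply/eqP => l0.
  have Arn : A ^+ (size rs) = 0.
    have := Cayley_Hamilton A; rewrite E.
    rewrite (eq_big_seq (fun=> 'X)) => [|x /lmax]; last first.
      by rewrite l0 normr0 normr_le0 => /eqP->; rewrite subr0.
    by rewrite big_const_seq count_predT -Monoid.iteropE /= rmorphXn /= horner_mx_X.
  have := AE (size rs); rewrite Arn mul0mx => /matrixP /(_ a 0); rewrite !mxE => /eqP.
  by rewrite eq_sym pnatr_eq0 eqn0Ngt X_gt0.
have [x xrs|x xrs xl|K1 [mu [muth Hdec]]] := exp_poly_decomposition E l0.
- by rewrite (le_trans (lmax _ xrs)) // -lE.
- rewrite -xl; apply: (dominant_eigen_pos A0 HK E xrs) => y /lmax yl.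
  by rewrite xl (le_trans yl) // -lE.
have /andP[mu0 mul] := muth.
have [Q [D [D0 HD]]] := Hdec (xcol s).
have lin_polyexp f : linform f -> exists qf, polyexp l mu K1 (fun t => (f (q * t + s)%N)%:R) qf.
  case=> al Hal; exists (fun j => \sum_i (al i)%:~R * Q j i 0).
  exists (\sum_i `|(al i)%:~R| * D); first by rewrite sumr_ge0 // => i _; rewrite mulr_ge0.
  move=> t.
  have -> : (f (q * t + s)%N)%:R = \sum_i (al i)%:~R * (A ^+ t *m xcol s) i 0 :> algC.
    rewrite AE -[LHS]/((f (q * t + s)%N)%:Z%:~R) Hal rmorph_sum /=.
    by apply: eq_bigr => i _; rewrite rmorphM /= mxE.
  have -> : l ^+ t * \sum_(j < K1) (\sum_i (al i)%:~R * Q j i 0) * 'C(t, j)%:R =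
     \sum_i (al i)%:~R * (l ^+ t * \sum_(j < K1) Q j i 0 * 'C(t, j)%:R).
    under eq_bigr do rewrite mulr_suml.
    rewrite exchange_big mulr_sumr; apply: eq_bigr => i _.
    rewrite mulrCA; congr (_ * _); rewrite mulr_sumr; apply: eq_bigr => j _.
    by rewrite mulrA.
  rewrite -sumrB mulr_suml; apply: le_trans (ler_norm_sum _ _ _) _.
  apply: ler_sum => i _; rewrite -mulrBr normrM -mulrA ler_wpM2l //.
have lina : linform (fun t => X t a).
  exists (fun j => (j == a)%:R) => t; rewrite (bigD1 a) //= eqxx mul1r big1 ?addr0 //.
  by move=> i /negPf->; rewrite mul0r.
have [B HB] := X_bounded.
have lin_le f : linform f -> exists Cf : nat, forall t, (f t <= Cf * X t a)%N.
  case=> al Hal; exists (\sum_i `|al i|%N * B)%N => t.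
  rewrite -lez_nat Hal; apply: le_trans (ler_norm _) _.
  apply: le_trans (ler_norm_sum _ _ _) _; rewrite big_distrl /= -[leRHS]natz natr_sum.
  apply: ler_sum => i _; rewrite normrM -mulnA natrM !natz.
  by rewrite ler_wpM2l // lez_nat HB.
have [qa pa] := lin_polyexp _ lina.
have [qn pn] := lin_polyexp _ lnum.
have [qd pd] := lin_polyexp _ lden.
have [Cn HCn] := lin_le _ lnum; have [Cd HCd] := lin_le _ lden.
pose CC := (Cn + Cd + C')%N.
apply: (ratio_converges mu0 mul (C := CC%:R) pa pn pd); rewrite ?ler0n //.
- move=> t; rewrite ger0_norm ?ler0n // -natrM ler_nat (leq_trans (HCn _)) //.
  by rewrite leq_mul2r /CC -addnA leq_addr orbT.
- move=> t; rewrite -natrM ler_nat (leq_trans (HCd _)) //.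
  by rewrite leq_mul2r /CC addnAC leq_addl orbT.
- move=> t; rewrite -natrM ler_nat (leq_trans (aden _)) //.
  by rewrite leq_mul2r /CC leq_addl orbT.
(* If [X t a] were [O(mu^t)], so would be all entries of [A^t] by [m_le], contradicting
   [v A^t = l^t v] with [mu < l]. *)
move=> D1 D10 HD1.
have [j vj] : exists j, v 0 j != 0.
  by apply/existsP; apply: contraNT vn0; rewrite negb_exists => /forallP h;
     apply/eqP/rowP=> j; rewrite !mxE; apply/eqP; have := h j; rewrite negbK.
have vj0 : 0 < `|v 0 j| by rewrite normr_gt0.
have vAt t : v *m A ^+ t = l ^+ t *: v.
  elim: t => [|t IH]; first by rewrite expr0 mulmx1 scale1r.
  by rewrite exprSr -mulmxE mulmxA IH -scalemxAl vA scalerA -exprSr.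
apply: (@expr_dominated l mu `|v 0 j| ((\sum_i `|v 0 i|) * (C%:R * D1))) => //.
  by rewrite !mulr_ge0 ?ler0n // sumr_ge0.
move=> t; have -> : `|v 0 j| * l ^+ t = `|(v *m A ^+ t) 0 j|.
  by rewrite vAt mxE normrM normrX -lE mulrC.
apply: le_trans (mulmx_norm_le _ _ _) _; first by move=> i k; rewrite /A -exprM m_ge0.
rewrite -mulrA mulr_suml; apply: ler_sum => i _; rewrite ler_wpM2l // /A -exprM.
apply: le_trans (m_le _ _ _) _; rewrite natrM -mulrA ler_wpM2l ?ler0n //.
by apply: le_trans (HD1 t); rewrite ler_nat X_le.
Qed.

End Ratio.

(** * Algebraic limits: from [algC] to [R] *)

Lemma poly_lipschitz (F : numFieldType) (p : {poly F}) (c : F) :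
  exists2 B, 0 <= B & forall x, `|x - c| <= 1 -> `|p.[x] - p.[c]| <= B * `|x - c|.
Proof.
have /factor_theorem [q qE] : root (p - p.[c]%:P) c by rewrite /root !hornerE subrr.
have [B HB] := poly_disk_bound q (`|c| + 1).
have B0 : 0 <= B.
  by apply: le_trans (HB c _); rewrite ?normr_ge0 // lerDl ler01.
exists B => // x xc; have -> : p.[x] - p.[c] = (p - p.[c]%:P).[x] by rewrite !hornerE.
rewrite qE hornerM normrM !hornerE ler_wpM2r // HB //.
by rewrite -[x](subrK c) (le_trans (ler_normD _ _)) // addrC lerD2l.
Qed.

Lemma poly_seq_continuous (F : numFieldType) (p : {poly F}) (c : F) (x : nat -> F) :
  (forall e, 0 < e -> exists T, forall t, (T <= t)%N -> `|x t - c| <= e) ->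
  forall e, 0 < e -> exists T, forall t, (T <= t)%N -> `|p.[x t] - p.[c]| <= e.
Proof.
move=> Hx e e0; have [B B0 HB] := poly_lipschitz p c.
have B1 : 0 < B + 1 by rewrite ltr_wpDl.
have [T1 H1] := Hx _ ltr01; have [T2 H2] := Hx _ (divr_gt0 e0 B1).
exists (maxn T1 T2) => t; rewrite geq_max => /andP[/H1 h1 /H2 h2].
apply: le_trans (HB _ h1) _.
apply: (@le_trans _ _ ((B + 1) * (e / (B + 1)))); first by apply: ler_pM => //; rewrite lerDl.
by rewrite mulrC divfK ?gt_eqF.
Qed.

Definition Z_of_int (z : int) : Z :=
  match z with Posz n => Z.of_nat n | Negz n => Z.opp (Z.of_nat n.+1) end.

Lemma IZR_Z_of_int z : IZR (Z_of_int z) = z%:~R.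
Proof.
case: z => n /=; first by rewrite -INR_IZR_INZ INRE.
by rewrite -Pos2Z.opp_pos opp_IZR -[Z.pos _]/(Z.of_nat n.+1) -INR_IZR_INZ INRE NegzE rmorphN.
Qed.

Lemma eval_Zpoly_horner (p : {poly int}) (x : R) :
  eval_Zpoly (map Z_of_int p) x = (map_poly intr p : {poly R}).[x].
Proof.
suff h (s : seq int) : eval_Zpoly (map Z_of_int s) x = (\poly_(i < size s) (s`_i)%:~R).[x] by exact: h.
rewrite horner_poly; elim: s => [|c s IH]; first by rewrite big_ord0.
transitivity (IZR (Z_of_int c) + x * eval_Zpoly (map Z_of_int s) x)%R; first by [].
rewrite big_ord_recl expr0 mulr1 IH IZR_Z_of_int; congr (_ + _).
by rewrite mulr_sumr; apply: eq_bigr => i _; rewrite mulrCA exprS.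
Qed.

(** Used in both directions, this carries Cauchy estimates from [algC] to [R] through [rat]. *)
Lemma nat_ratio_transfer (F : numFieldType) (a b a' b' : nat) (e : rat) :
  (`|a%:R / b%:R - a'%:R / b'%:R : F| <= ratr e) = (`|a%:R / b%:R - a'%:R / b'%:R| <= e).
Proof.
by rewrite -(ler_rat F) ratr_norm rmorphB !fmorph_div !rmorph_nat.
Qed.


(* [L] is not mapped to [R]: the ratios are a Cauchy sequence of rationals, and
   their real limit is a root of every integer polynomial vanishing at [L]. *)
Lemma ratio_limit_real (num den : nat -> nat) (L : algC) :
  (forall t, (0 < den t)%N) ->
  (forall e, 0 < e -> exists T, forall t, (T <= t)%N ->
    `|(num t)%:R - L * (den t)%:R| <= e * (den t)%:R) ->
  exists r, is_algebraic r /\ Un_cv (fun t => Rdiv (INR (num t)) (INR (den t))) r.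
Proof.
move=> den0 HL.
pose x (F : numFieldType) t : F := (num t)%:R / (den t)%:R.
have xQ (F : numFieldType) t : x F t = ratr (x rat t) by rewrite fmorph_div !rmorph_nat.
have HL' e : 0 < e -> exists T, forall t, (T <= t)%N -> `|x algC t - L| <= e.
  move=> e0; have [T HT] := HL e e0; exists T => t /HT.
  have d0 : 0 < (den t)%:R :> algC by rewrite ltr0n.
  have -> : x algC t - L = ((num t)%:R - L * (den t)%:R) / (den t)%:R.
    by rewrite mulrBl mulfK ?gt_eqF.
  by rewrite normrM normfV (gtr0_norm d0) ler_pdivrMr.
have small_rat (eps : R) : Rlt R0 eps -> exists2 e : rat, 0 < e & ratr e < eps.
  case/archimed_cor1 => N [Neps /ssrnat.ltP N0].
  exists N%:R^-1; first by rewrite invr_gt0 ltr0n.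
  by rewrite fmorphV rmorph_nat -INRE; apply/RltP.
have cauchy (e : rat) : 0 < e -> exists T, forall s t, (T <= s)%N -> (T <= t)%N ->
    `|x R s - x R t| <= ratr e.
  move=> e0; have [|T HT] := HL' (ratr (e / 2%:R)); first by rewrite ltr0q divr_gt0.
  exists T => s t /HT hs /HT ht; rewrite nat_ratio_transfer -(nat_ratio_transfer algC).
  rewrite -(subrKA L) (le_trans (ler_normD _ _)) // (distrC L).
  by rewrite [e]splitr rmorphD lerD.
have [r Hr] : {r | Un_cv (x R) r}.
  apply: R_complete => eps /small_rat [e e0 eeps].
  have [T HT] := cauchy e e0; exists T => s t /ssrnat.leP sT /ssrnat.leP tT.
  by rewrite RdistE; apply/RltP; apply: le_lt_trans eeps; exact: HT.
exists r; split; last first.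
  move=> eps /Hr [T HT]; exists T => t /HT.
  by rewrite RdivE !INRE.
have Hr' (e : R) : 0 < e -> exists T, forall t, (T <= t)%N -> `|x R t - r| <= e.
  move=> /RltP /Hr [T HT]; exists T => t /ssrnat.leP /HT.
  by rewrite RdistE => /RltP/ltW.
(* [p] is the minimal polynomial of [L] over the rationals with denominators cleared. *)
have [p0 [_ p0m p0r]] := minCpolyP L.
have [p [a a0 pE]] := rat_poly_scale p0.
have pn0 : p != 0.
  by apply: contraTneq p0m => p_eq0; rewrite pE p_eq0 rmorph0 scaler0 monicE lead_coef0 eq_sym oner_eq0.
have aE : a%:~R != 0 :> rat by rewrite intr_eq0.
have pL : (map_poly intr p : {poly algC}).[L] = 0.
  have := p0r p0; rewrite dvdpp pE map_polyZ -map_poly_comp.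
  rewrite (eq_map_poly (g := intr)) => [|z]; last by rewrite /= ratr_int.
  by rewrite rootZ ?fmorph_eq0 ?invr_eq0 // => /rootP.
exists (map Z_of_int p); split.
  exists (Z_of_int (lead_coef p)); split.
    suff h : lead_coef p \in (p : seq int).
      elim: (p : seq int) h => //= c s IH; rewrite inE => /orP[/eqP->|/IH]; [by left|by right].
    by rewrite lead_coefE mem_nth // prednK // size_poly_gt0.
  move=> /(congr1 IZR); rewrite IZR_Z_of_int => /eqP; rewrite intr_eq0 lead_coef_eq0.
  by rewrite (negPf pn0).
rewrite eval_Zpoly_horner; apply/eqP; rewrite -normr_eq0 eq_le normr_ge0 andbT.
apply/ler_addgt0Pr => eps eps0; rewrite add0r.
have eps2 : 0 < eps / 2%:R by rewrite divr_gt0.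
have [e e0 eeps] : exists2 e : rat, 0 < e & ratr e < eps / 2%:R by apply/small_rat/RltP.
have [T1 H1] := poly_seq_continuous (map_poly intr p) Hr' eps2.
have eC : 0 < ratr e :> algC by rewrite ltr0q.
have [T2 H2] := poly_seq_continuous (map_poly intr p) HL' eC.
pose t := maxn T1 T2.
have h1 := H1 t (leq_maxl _ _); have := H2 t (leq_maxr _ _).
(* Values of [p] at the ratios are rational, so their smallness near the root [L] in [algC] is also
   smallness in [R]. *)
have PQ (F : numFieldType) : (map_poly intr p : {poly F}).[x F t] = ratr (map_poly intr p).[x rat t].
  rewrite xQ -horner_map -map_poly_comp; congr (_.[_]).
  by apply: eq_map_poly => z; rewrite /= ratr_int.
rewrite pL subr0 PQ -ratr_norm ler_rat -(ler_rat R) ratr_norm -PQ => h2.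
rewrite -(subrK (map_poly intr p).[x R t] (map_poly intr p).[r]) [eps]splitr.
rewrite (le_trans (ler_normD _ _)) // lerD //; first by rewrite distrC.
exact: le_trans h2 (ltW eeps).
Qed.

(** Reindexes [J] by ordinals and moves the limit to [R]. The bound of [X t a] by [den] also keeps
    the denominators positive. *)
Theorem linear_form_ratio (J : finType) (M : J -> J -> nat) (X Y : nat -> J -> nat) (a : J) (C : nat) :
  (forall t i, X t.+1 i = (\sum_j M i j * X t j)%N) ->
  (forall i, (0 < Y 0 i)%N) ->
  (forall t i, (\sum_j M i j * Y t j <= Y t.+1 i)%N) ->
  (forall t i, (Y t i <= C * X t a)%N) ->
  (forall t, (X t a <= X t.+1 a)%N) -> (0 < X 0 a)%N ->
  exists q, (0 < q)%N /\ forall s num den C',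
  linear_form X num -> linear_form X den -> (forall t, X t a <= C' * den t)%N ->
  exists r, is_algebraic r /\
    Un_cv (fun t => Rdiv (INR (num (q * t + s)%N)) (INR (den (q * t + s)%N))) r.
Proof.
move=> Xrec Y0 Ysup Yle Xmono X0.
have cardJ : #|J| = #|J|.-1.+1 by rewrite prednK //; apply/card_gt0P; exists a.
pose f (i : 'I_(#|J|.-1.+1)) : J := enum_val (cast_ord (esym cardJ) i).
pose g (j : J) : 'I_(#|J|.-1.+1) := cast_ord cardJ (enum_rank j).
have fK : cancel f g by move=> i; rewrite /f /g enum_valK cast_ordKV.
have gK : cancel g f by move=> j; rewrite /f /g cast_ordK enum_rankK.
have bij : {on [pred j | true], bijective f} by exists g => x _.
have [|//|||||q q0 Hq] := @linform_ratio _ (fun i j => M (f i) (f j)) (fun t i => X t (f i))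
  (fun t i => Y t (f i)) (g a) C.
- by move=> t i; rewrite Xrec (reindex f) //.
- by move=> t i; apply: leq_trans (Ysup t (f i)); rewrite [leqRHS](reindex f).
- by move=> t i; rewrite gK.
- by move=> t; rewrite gK.
- by rewrite gK.
have lin n : linear_form X n -> linear_form (fun t i => X t (f i)) n.
  by case=> al H; exists (fun i => al (f i)) => t; rewrite H (reindex f).
exists q; split=> // s num den C' /lin lnum /lin lden aden.
have [|L HL] := Hq s num den C' lnum lden; first by move=> t; rewrite gK.
apply: (@ratio_limit_real (fun t => num (q * t + s)%N) (fun t => den (q * t + s)%N)) HL => t.
have := aden (q * t + s)%N; case: (den _) => //; rewrite muln0 leqNgt.
suff -> : (0 < X (q * t + s)%N a)%N by [].
by elim: (q * t + s)%N => // i IH; exact: leq_trans (Xmono i).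
Qed.
End LinearRecurrence.

(** * Runs in fixed points of morphisms *)

Module MorphicWord.
Import all_boot all_order all_algebra zify LinearRecurrence.
Set Implicit Arguments.
Unset Strict Implicit.
Unset Printing Implicit Defensive.
Local Open Scope nat_scope.

(** * Iterated images of words, and their extreme blocks in [Z] *)

Section Iterates.
Variable g : nat -> seq nat.

Definition ext (w : seq nat) : seq nat := flatten (map g w).
Definition img t (w : seq nat) : seq nat := iter t ext w.

Lemma ext_cat w1 w2 : ext (w1 ++ w2) = ext w1 ++ ext w2.
Proof. by rewrite /ext map_cat flatten_cat. Qed.

Lemma ext1 c : ext [:: c] = g c.
Proof. by rewrite /ext /= cats0. Qed.

Lemma img_cat t w1 w2 : img t (w1 ++ w2) = img t w1 ++ img t w2.
Proof. by elim: t => //= t ->; rewrite ext_cat. Qed.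

Lemma img_nil t : img t [::] = [::].
Proof. by elim: t => //= t ->. Qed.

Lemma img_cons t c w : img t (c :: w) = img t [:: c] ++ img t w.
Proof. by rewrite -cat1s img_cat. Qed.

Lemma imgSr t w : img t.+1 w = img t (ext w).
Proof. by rewrite /img iterSr. Qed.

Lemma imgS1 t c : img t.+1 [:: c] = img t (g c).
Proof. by rewrite imgSr ext1. Qed.

Lemma imgD s t w : img (s + t) w = img s (img t w).
Proof. by rewrite /img iterD. Qed.

(** Finds the ancestor in [w] of a marked letter of the image, with the induced splitting on both
    sides. *)
Lemma img_split t w A x R : img t w = A ++ x :: R ->
  exists w1 c w2 A' R', [/\ w = w1 ++ c :: w2, img t [:: c] = A' ++ x :: R',
    A = img t w1 ++ A' & R = R' ++ img t w2].
Proof.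
elim: w A => [|c w IH] A; first by rewrite img_nil; case: A.
rewrite img_cons => E.
have [lt|le] := ltnP (size A) (size (img t [:: c])).
  have E1 := congr1 (take (size (img t [:: c]))) E.
  have E2 := congr1 (drop (size (img t [:: c]))) E.
  rewrite take_size_cat // in E1; rewrite drop_size_cat // in E2.
  exists [::], c, w, A, (take (size (img t [:: c]) - (size A).+1) R).
  rewrite img_nil /=; split=> //.
    rewrite {1}E1 take_cat ltnNge (ltnW lt) /=.
    by rewrite -[in take (_ - size A)](subnSK lt).
  rewrite E2 drop_cat ltnNge (ltnW lt) /= -[in drop (_ - size A)](subnSK lt) /=.
  by rewrite cat_take_drop.
have E1 := congr1 (take (size (img t [:: c]))) E.
have E2 := congr1 (drop (size (img t [:: c]))) E.
rewrite take_size_cat // takel_cat // in E1; rewrite drop_size_cat // in E2.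
have E3 : drop (size (img t [:: c])) (A ++ x :: R) = drop (size (img t [:: c])) A ++ x :: R.
  rewrite drop_cat; case: ltnP => // le'.
  have -> : size (img t [:: c]) = size A by apply/eqP; rewrite eqn_leq le le'.
  by rewrite subnn drop_size.
rewrite E3 in E2; have [w1 [d [w2 [A' [R' [-> h1 h2 h3]]]]]] := IH _ E2.
exists (c :: w1), d, w2, A', R'; split=> //.
by rewrite img_cons -catA -h2 {1}E1 cat_take_drop.
Qed.

Variable Z : pred nat.
Let N : pred nat := predC Z.

(** Length of the longest prefix in [Z^*]: [find] returns the whole length when no letter lies
    outside [Z]. *)
Definition lead (w : seq nat) := find N w.
Definition trail (w : seq nat) := find N (rev w).

Lemma lead_cat_all B w : all Z B -> lead (B ++ w) = size B + lead w.
Proof. by move=> ZB; rewrite /lead find_cat has_predC ZB. Qed.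

Lemma trail_cat_all w B : all Z B -> trail (w ++ B) = trail w + size B.
Proof. by move=> ZB; rewrite /trail rev_cat find_cat has_predC all_rev ZB size_rev addnC. Qed.

Lemma lead_cat_has B w : ~~ all Z B -> lead (B ++ w) = lead B.
Proof. by move=> ZB; rewrite /lead find_cat has_predC ZB. Qed.

Lemma trail_cat_has w B : ~~ all Z B -> trail (w ++ B) = trail B.
Proof. by move=> ZB; rewrite /trail rev_cat find_cat has_predC all_rev ZB. Qed.

Lemma lead_stop B y C : all Z B -> ~~ Z y -> lead (B ++ y :: C) = size B.
Proof. by move=> ZB Zy; rewrite lead_cat_all // /lead /= /N /= Zy addn0. Qed.

Lemma trail_stop A x R : all Z R -> ~~ Z x -> trail (A ++ x :: R) = size R.
Proof.
by move=> ZR Zx; rewrite -cat_rcons trail_cat_all // /trail rev_rcons /= /N /= Zx.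
Qed.

Lemma lead_size w : lead w <= size w.
Proof. exact: find_size. Qed.

Lemma trail_size w : trail w <= size w.
Proof. by rewrite -(size_rev w); exact: find_size. Qed.

Lemma trailE w : exists A B, [/\ w = A ++ B, all Z B & size B = trail w].
Proof.
exists (rev (drop (trail w) (rev w))), (rev (take (trail w) (rev w))).
rewrite -rev_cat cat_take_drop revK; split=> //.
  rewrite all_rev; apply/(all_nthP 0) => i; rewrite size_take size_rev.
  rewrite (_ : (if _ then _ else _) = trail w); last by have := trail_size w; case: ltngtP.
  by move=> lt; rewrite nth_take //; have := before_find 0 lt; rewrite /N /= => /negbFE.
by rewrite size_rev size_take size_rev; have := trail_size w; case: ltngtP.
Qed.

Lemma leadE w : exists A B, [/\ w = A ++ B, all Z A & size A = lead w].
Proof.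
exists (take (lead w) w), (drop (lead w) w); rewrite cat_take_drop; split=> //.
  apply/(all_nthP 0) => i; rewrite size_take.
  rewrite (_ : (if _ then _ else _) = lead w); last by have := lead_size w; case: ltngtP.
  by move=> lt; rewrite nth_take //; have := before_find 0 lt; rewrite /N /= => /negbFE.
by rewrite size_take; have := lead_size w; case: ltngtP.
Qed.

End Iterates.

(** * Runs in the fixed point as images of gaps *)

Section FixedPoint.
Variables (g : nat -> seq nat) (u : nat -> nat) (a : nat) (Z : pred nat).
Notation img := (img g).
Hypothesis u_pref : forall n, mkseq u (size (img n [:: a])) = img n [:: a].
Hypothesis img_grow : forall n, n < size (img n [:: a]).

Definition isprefix w := w = mkseq u (size w).

Lemma isprefix_catl w1 w2 : isprefix (w1 ++ w2) -> isprefix w1.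
Proof.
rewrite /isprefix size_cat => /(congr1 (take (size w1))).
rewrite take_size_cat // => ->; rewrite {1}/mkseq -map_take take_iota.
by rewrite size_map size_iota /mkseq; congr (map u (iota 0 _)); lia.
Qed.

Lemma isprefix_mkseq n : isprefix (mkseq u n).
Proof. by rewrite /isprefix size_mkseq. Qed.

(** Iterates of [a] grow, so [w] is a prefix of one of them, and its image is a prefix of a later
    one. *)
Lemma isprefix_img t w : isprefix w -> isprefix (img t w).
Proof.
move=> Hw; have [r E] : exists r, img (size w) [:: a] = w ++ r.
  exists (drop (size w) (img (size w) [:: a])).
  suff {2}<- : take (size w) (img (size w) [:: a]) = w by rewrite cat_take_drop.
  rewrite -u_pref [RHS]Hw /mkseq -map_take take_iota.
  by congr (map u (iota 0 _)); have := img_grow (size w); lia.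
apply: (@isprefix_catl _ (img t r)); rewrite -img_cat -E -imgD /isprefix.
by rewrite u_pref.
Qed.

Lemma isprefix_nth w1 c w2 : isprefix (w1 ++ c :: w2) -> u (size w1) = c.
Proof.
move=> E; have := congr1 (fun s => nth 0 s (size w1)) E.
by rewrite nth_cat ltnn subnn /= nth_mkseq ?size_cat /= ?addnS ?ltnS ?leq_addr.
Qed.

(* Start and length of the run of [Z] that [g^t] produces in [u] from a factor
   [al x v y] of [g c], for an occurrence of [c] preceded by the prefix [P],
   when [g^t v] is in [Z^*] and [g^t x], [g^t y] are not. *)
Definition gap_start t P al x := size (img t (ext g P ++ al ++ [:: x])) - trail Z (img t [:: x]).
Definition gap_size t x v y := trail Z (img t [:: x]) + size (img t v) + lead Z (img t [:: y]).

(** Let [d] be the ancestor of [x'] in the image of [c] under [g]. If the next-level image of [d]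
    also contains [y'], descend into [d] with a longer prefix. Otherwise [y'] has a different
    ancestor [e], the word [v] between [d] and [e] is mapped into [Z^*], and the gap is found. *)
Lemma gap_descent t P c A x' B y' C : isprefix (rcons P c) ->
  img t [:: c] = A ++ x' :: B ++ y' :: C -> ~~ Z x' -> ~~ Z y' -> all Z B ->
  exists s P1 c1 al x v y be, s < t /\
   [/\ isprefix (rcons P1 c1), g c1 = al ++ x :: v ++ y :: be,
     [&& ~~ all Z (img s [:: x]), ~~ all Z (img s [:: y]) & all Z (img s v)],
     (size (img t P) + size A).+1 = gap_start s P1 al x & size B = gap_size s x v y].
Proof.
elim: t P c A C => [|t IH] P c A C Pc.
  by move=> /(congr1 size); rewrite /= !size_cat /= size_cat /=; lia.
rewrite imgS1 => E Zx Zy ZB.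
have [w1 [d [w2 [A' [R' [Ew Ed EA ER]]]]]] := img_split E.
have Pd w3 : w2 = w3 -> isprefix (rcons (ext g P ++ w1) d).
  move=> _; apply: (@isprefix_catl _ w2).
  have := isprefix_img 1 Pc; rewrite /img /= -cats1 ext_cat ext1 Ew.
  by rewrite -cats1 -!catA.
have sizeP : size (img t.+1 P) + size A = size (img t (ext g P ++ w1)) + size A'.
  by rewrite imgSr img_cat EA !size_cat addnA.
have [lt|le] := ltnP (size B) (size R').
  have ER' : R' = B ++ y' :: take (size R' - (size B).+1) C.
    have := congr1 (take (size R')) ER; rewrite [in RHS]take_size_cat //.
    by rewrite take_cat ltnNge (ltnW lt) /= -[in take (_ - size B)](subnSK lt).
  have [s [P1 [c1 [al [x [v [y [be [st H]]]]]]]]] := IH _ _ _ _ (Pd w2 erefl) (etrans Ed (congr1 (fun r => A' ++ x' :: r) ER')) Zx Zy ZB.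
  exists s, P1, c1, al, x, v, y, be; split; first exact: ltnW.
  by rewrite sizeP.
have [B2 EB] : exists B2, B = R' ++ B2.
  exists (drop (size R') B); have := congr1 (take (size R')) ER.
  by rewrite [RHS]take_size_cat // takel_cat // => {1}<-; rewrite cat_take_drop.
have E2 : img t w2 = B2 ++ y' :: C.
  by have := congr1 (drop (size R')) ER; rewrite EB -catA !drop_size_cat.
have [v [e [w3 [B3 [R3 [Ew2 Ee EB2 EC]]]]]] := img_split E2.
move: ZB; rewrite EB EB2 !all_cat => /and3P[ZR Zv ZB3].
exists t, P, c, w1, d, v, e, w3; split=> //; split=> //.
- by rewrite Ew Ew2.
- by rewrite Ed Ee Zv !all_cat /= (negPf Zx) (negPf Zy) !andbF.
- rewrite sizeP /gap_start !img_cat Ed !size_cat trail_stop //=; lia.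
- by rewrite /gap_size Ed Ee trail_stop // lead_stop // !size_cat addnA.
Qed.

Hypothesis Z_inf : forall n, exists2 m, n <= m & ~~ Z (u m).

Definition is_run i l := forall n, i <= n < i + l -> Z (u n).

(** Extend the run to a maximal one, between positions [p] and [p'], and descend from the iterate
    [img p' [:: a]]. The left boundary exists because a run longer than [m0] cannot start at or
    before [m0] without containing it. *)
Lemma run_covered : exists K, forall i l, is_run i l -> l <= K \/
  exists t P c al x v y be, [/\ isprefix (rcons P c), g c = al ++ x :: v ++ y :: be,
     [&& ~~ all Z (img t [:: x]), ~~ all Z (img t [:: y]) & all Z (img t v)],
     gap_start t P al x <= i & l <= gap_size t x v y].
Proof.
have [m0 _ Zm0] := Z_inf 0; exists m0 => i l run.
have [le|lt] := leqP l m0; [by left | right].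
have ex1 : exists n, (n < i) && ~~ Z (u n).
  exists m0; rewrite Zm0 andbT; rewrite ltnNge; apply/negP => im0.
  by move/negP: Zm0; apply; apply: run; lia.
have bnd n : (n < i) && ~~ Z (u n) -> n <= i by case/andP=> /ltnW.
have [p /andP[pi Zp] pmax] := ex_maxnP ex1 bnd.
have ex2 : exists n, (i + l <= n) && ~~ Z (u n).
  by have [m im Zm] := Z_inf (i + l); exists m; rewrite im.
have [p' /andP[ilp Zp'] pmin] := ex_minnP ex2.
have Zmid n : p < n < p' -> Z (u n).
  move=> /andP[pn np]; apply/idPn => Zn.
  have [ni|ni] := ltnP n i; first by have := pmax n; rewrite ni Zn => /(_ isT); lia.
  have [nl|nl] := ltnP n (i + l); first by move/negP: Zn; apply; apply: run; lia.
  by have := pmin n; rewrite nl Zn => /(_ isT); lia.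
pose B := [seq u n | n <- iota p.+1 (p' - p.+1)].
have sB : size B = p' - p.+1 by rewrite size_map size_iota.
have ZB : all Z B.
  by apply/allP => z /mapP[n]; rewrite mem_iota => h ->; apply: Zmid; lia.
pose C := [seq u n | n <- iota p'.+1 (size (img p' [:: a]) - p'.+1)].
have E : img p' [:: a] = mkseq u p ++ u p :: B ++ u p' :: C.
  rewrite -u_pref /mkseq /B /C.
  have -> : size (img p' [:: a]) = p + (1 + ((p' - p.+1) + (1 + (size (img p' [:: a]) - p'.+1)))).
    by have := img_grow p'; lia.
  rewrite !iotaD !map_cat !add0n /= ?addn1.
  have -> : p.+1 + (p' - p.+1) = p' by lia.
  congr (_ ++ _ :: _ ++ _ :: map u (iota _ _)); lia.
have Pa : isprefix (rcons [::] a) by by rewrite /isprefix /=; have := u_pref 0.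
have [s [P1 [c1 [al [x [v [y [be [_ [h1 h2 h3 h4 h5]]]]]]]]]] := gap_descent Pa E Zp Zp' ZB.
exists s, P1, c1, al, x, v, y, be; split=> //.
  by rewrite -h4 img_nil size_mkseq.
rewrite -h5 sB; lia.
Qed.

Lemma gap_is_run t P c al x v y be : isprefix (rcons P c) -> g c = al ++ x :: v ++ y :: be ->
  all Z (img t v) -> is_run (gap_start t P al x) (gap_size t x v y).
Proof.
move=> Pc Eg Zv.
have := isprefix_img t.+1 Pc; rewrite imgSr -cats1 ext_cat ext1 Eg.
have [A1 [B1 [E1 Z1 s1]]] := trailE Z (img t [:: x]).
have [A2 [B2 [E2 Z2 s2]]] := leadE Z (img t [:: y]).
rewrite img_cat img_cat img_cons E1 img_cat img_cons E2 => H.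
set W := img t (ext g P) ++ img t al ++ A1.
have sW : gap_start t P al x = size W.
  by rewrite /gap_start !img_cat E1 !size_cat -E1 -s1; lia.
have sB : gap_size t x v y = size (B1 ++ img t v ++ A2).
  by rewrite /gap_size !size_cat s1 s2 addnA.
have H' : isprefix (W ++ (B1 ++ img t v ++ A2) ++ (B2 ++ img t be)).
  by move: H; rewrite /W -!catA.
rewrite sW sB => n /andP[n1 n2].
have ZB : all Z (B1 ++ img t v ++ A2) by rewrite !all_cat Z1 Zv Z2.
have := congr1 (fun s => nth 0 s n) H'; rewrite nth_mkseq; last by rewrite !size_cat in n2 *; lia.
rewrite nth_cat ltnNge n1 /= nth_cat ifT; last by rewrite ltn_subLR.
by move=> <-; apply: (allP ZB); apply: mem_nth; rewrite ltn_subLR.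
Qed.
End FixedPoint.

(** The orbit of [x] under [lam] reaches a periodic letter [y] after [i] steps, with period [p].
    There [T (t + p) y = K^t A + T t y], so [T t y] is [A K^t / (K^p - 1)] up to a bounded error;
    [i] more steps bring this back to [x]. *)
Lemma geometric_recurrence (K k : nat) (good : pred nat) (lam sg : nat -> nat) (T : nat -> nat -> nat) :
  1 < K -> (forall x, good x -> x < k) -> (forall x, good x -> good (lam x)) ->
  (forall t x, 0 < t -> good x -> T t.+1 x = K ^ t * sg x + T t (lam x)) ->
  forall x, good x -> exists r, geometric K (fun t => T t x) r.
Proof.
move=> K1 good_lt good_lam Trec x gx.
have gi n y : good y -> good (iter n lam y) by move=> gy; elim: n => //= n; exact: good_lam.
have Titer n y : good y -> exists s, forall t, 0 < t -> T (t + n) y = K ^ t * s + T t (iter n lam y).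
  elim: n y => [|n IH] y gy; first by exists 0 => t _; rewrite muln0 addn0.
  have [s Hs] := IH (lam y) (good_lam _ gy); exists (K ^ n * sg y + s) => t t0.
  by rewrite addnS Trec ?addn_gt0 ?t0 // Hs // -iterSr expnD mulnDr mulnA addnA.
pose F (i : 'I_k.+1) : 'I_k := Ordinal (good_lt _ (gi i _ gx)).
have [i [j [ij Fij]]] : exists i j : nat, i < j /\ iter i lam x = iter j lam x.
  have /injectivePn [i [j ij E]] : ~~ injectiveb F.
    by apply/negP => /injectiveP/leq_card; rewrite !card_ord ltnn.
  have {}E : iter i lam x = iter j lam x by case: E.
  have : nat_of_ord i != j by [].
  by rewrite neq_ltn => /orP[h|h]; [exists i, j | exists j, i].
set y := iter i lam x in Fij; pose p := j - i; have p0 : 0 < p by rewrite subn_gt0.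
have gy : good y := gi i x gx.
have py : iter p lam y = y by rewrite /y -iterD subnK ?(ltnW ij).
have [A HA] := Titer p y gy; rewrite py in HA.
have [s Hs] := Titer i x gx; rewrite -/y in Hs.
pose e := K ^ p - 1.
have Kp : K ^ p = e.+1 by rewrite /e subn1 prednK // expn_gt0 (ltnW K1).
have e0 : 0 < e.
  rewrite /e subn_gt0; apply: (@leq_trans K) => //.
  by rewrite -[X in X <= _](expn1 K) leq_exp2l // /p subn_gt0.
(* The sum covers the initial values [t <= p]; going from [t - p] to [t] is exact and preserves the
   error bound. *)
have [B HB] : exists B, forall t, 0 < t -> e * T t y <= K ^ t * A + B /\ K ^ t * A <= e * T t y + B.
  exists (\sum_(t < p.+1) (e * T t y + K ^ t * A)) => t.
  elim/ltn_ind: t => t IH t0; have [tp|pt] := leqP t p.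
    by rewrite (bigD1 (Ordinal (tp : t < p.+1))) //=; lia.
  have [h1 h2] := IH (t - p) ltac:(lia) ltac:(lia).
  have Et : t = t - p + p by lia.
  rewrite [in T t y]Et [in K ^ t]Et HA; last by lia.
  rewrite expnD Kp; move: h1 h2; set b := \sum_(_ < _) _; set c := K ^ (t - p); set d := T (t - p) y.
  rewrite mulnDr; nia.
pose D := e * K ^ i; pose P := A + e * s.
exists (Rdiv (INR P) (INR D)).
pose B' := K ^ i * B + \sum_(t < i.+1) (D * T t x + P * K ^ t).
have powE n : PeanoNat.Nat.pow K n = K ^ n by elim: n => //= n ->; rewrite expnS.
apply: (@geometric_of_nat _ _ P D B').
  by apply/ltP; rewrite muln_gt0 e0 expn_gt0 (ltnW K1).
move=> t /ltP t0; rewrite powE.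
suff : D * T t x <= P * K ^ t + B' /\ P * K ^ t <= D * T t x + B' by case=> /leP h1 /leP h2.
rewrite /B'; have [ti|it] := leqP t i.
  by rewrite (bigD1 (Ordinal (ti : t < i.+1))) //=; lia.
have [h1 h2] := HB (t - i) ltac:(lia).
have Et : t = t - i + i by lia.
set b := \sum_(_ < _) _.
rewrite [in T t x]Et [in K ^ t]Et Hs; last by lia.
rewrite expnD /D /P; move: h1 h2; set c := K ^ (t - i); set d := T (t - i) y; set q := K ^ i.
move=> /(leq_mul (leqnn q)) h1 /(leq_mul (leqnn q)) h2.
lia.
Qed.

(** These are the hypotheses of [vb_of_runs], restricted to the runs of one digit. *)
Definition gap_ratios_in (P : R -> Prop) (u : nat -> nat) (Z : pred nat) :=
  exists G : list ((nat -> nat) * (nat -> nat)),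
   [/\ (forall D I, List.In (D, I) G -> exists r, P r /\ Un_cv (fun t => Rdiv (INR (D t)) (INR (I t))) r),
       (forall D I, List.In (D, I) G -> forall N, exists T, forall t, T <= t -> N <= I t),
       (forall D I, List.In (D, I) G -> forall t, is_run u Z (I t) (D t)) &
       (forall T, exists K, forall i l, is_run u Z i l -> l <= K \/
          exists D I t, List.In (D, I) G /\ [/\ T <= t, I t <= i & l <= D t])].

(** * Gaps of a morphism with stable images in [Z] *)

Section Stable.
Variables (k : nat) (g : nat -> seq nat) (u : nat -> nat) (a : nat) (Z : pred nat).
Notation img := (img g).
Notation below := (fun d => d < k).
Hypothesis g_lt : forall c, c < k -> all below (g c).
Hypothesis a_lt : a < k.
Hypothesis u_pref : forall n, mkseq u (size (img n [:: a])) = img n [:: a].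
Hypothesis img_grow : forall n, n < size (img n [:: a]).
Hypothesis g_a : exists w, g a = a :: w.
Hypothesis Z_stable : forall c t, c < k -> 0 < t -> all Z (img t [:: c]) = all Z (g c).

(** By [Z_stable], a letter below [k] is in [Z1] exactly when its images under all positive powers
    of [g] are in [Z^*]. *)
Definition Z1 : pred nat := fun c => all Z (g c).

Lemma img_below t w : all below w -> all below (img t w).
Proof.
elim: t => //= t IH /IH; move: (img t w) => r; elim: r => //= c s IHs /andP[ck sk].
by rewrite -cat1s ext_cat ext1 all_cat g_lt //= IHs.
Qed.

Lemma all_Z_img t w : 0 < t -> all below w -> all Z (img t w) = all Z1 w.
Proof.
move=> t0; elim: w => [|c w IH] /=; first by rewrite img_nil.
by case/andP=> ck /IH IHw; rewrite img_cons all_cat IHw Z_stable.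
Qed.

Lemma all_Z_g c : c < k -> all Z1 (g c) = Z1 c.
Proof.
move=> ck; rewrite -(@all_Z_img 1) ?g_lt //.
by rewrite -imgS1 Z_stable.
Qed.

Lemma u_lt n : u n < k.
Proof.
have := @img_below n [:: a]; rewrite /= a_lt => /(_ isT) /allP; apply.
by rewrite -u_pref; apply/mapP; exists n; rewrite // mem_iota /=.
Qed.

(** [g y] is cut at its first letter outside [Z1]. The pair [sfx], [prv] does the same from the
    right, with [sfx] stored reversed. *)
Definition pfx y := take (lead Z1 (g y)) (g y).
Definition nxt y := nth 0 (g y) (lead Z1 (g y)).
Definition sfx x := take (trail Z1 (g x)) (rev (g x)).
Definition prv x := nth 0 (rev (g x)) (trail Z1 (g x)).

Lemma find_decomposition (P : pred nat) w : ~~ all P w ->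
  [/\ w = take (find (predC P) w) w ++ nth 0 w (find (predC P) w) :: drop (find (predC P) w).+1 w,
      all P (take (find (predC P) w) w) & ~~ P (nth 0 w (find (predC P) w))].
Proof.
rewrite -has_predC => hw; split.
- by rewrite -drop_nth -?has_find // cat_take_drop.
- have := leadE P w => -[A [B [E PA sA]]].
  by rewrite -[find _ _]/(lead P w) -sA E take_size_cat.
- exact: (nth_find 0 hw).
Qed.

Lemma nxtE y : y < k -> ~~ Z1 y -> exists be,
  [/\ g y = pfx y ++ nxt y :: be, all Z1 (pfx y) & ~~ Z1 (nxt y)].
Proof.
move=> yk; rewrite -all_Z_g // => /find_decomposition [h1 h2 h3].
by eexists; split; [exact: h1 | exact: h2 | exact: h3].
Qed.

Lemma prvE x : x < k -> ~~ Z1 x -> exists al,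
  [/\ g x = al ++ prv x :: rev (sfx x), all Z1 (sfx x) & ~~ Z1 (prv x)].
Proof.
move=> xk; rewrite -all_Z_g // -all_rev => /find_decomposition [h1 h2 h3].
exists (rev (drop (trail Z1 (g x)).+1 (rev (g x)))); split=> //.
by rewrite -[LHS]revK {1}h1 rev_cat rev_cons cat_rcons.
Qed.

(** The image of [pfx y] is in [Z^*] and that of [nxt y] is not, so later letters do not count.
    Membership in [Z1] only speaks of positive powers, hence [0 < t]. *)
Lemma lead_rec t y : y < k -> ~~ Z1 y -> 0 < t ->
  lead Z (img t.+1 [:: y]) = size (img t (pfx y)) + lead Z (img t [:: nxt y]).
Proof.
move=> yk /(nxtE yk) [be [E h1 h2]] t0; have := g_lt yk.
rewrite imgS1 E all_cat /= => /and3P[k1 k2 k3].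
rewrite img_cat img_cons lead_cat_all ?all_Z_img // lead_cat_has //.
by rewrite all_Z_img //= ?k2 // andbT.
Qed.

Lemma trail_rec t x : x < k -> ~~ Z1 x -> 0 < t ->
  trail Z (img t.+1 [:: x]) = size (img t (rev (sfx x))) + trail Z (img t [:: prv x]).
Proof.
move=> xk /(prvE xk) [al [E h1 h2]] t0; have := g_lt xk.
rewrite imgS1 E all_cat /= => /and3P[k1 k2 k3].
rewrite img_cat img_cons catA trail_cat_all ?all_Z_img // ?all_rev //.
by rewrite trail_cat_has ?all_Z_img //= ?k2 ?andbT // addnC.
Qed.

Definition gap m al x v y be :=
  [/\ g (u m) = al ++ x :: v ++ y :: be, ~~ Z1 x, ~~ Z1 y & all Z1 v].

Lemma isprefix_occ m : isprefix u (rcons (mkseq u m) (u m)).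
Proof.
have -> : rcons (mkseq u m) (u m) = mkseq u m.+1.
  by rewrite /mkseq -(addn1 m) iotaD map_cat cats1 add0n.
exact: isprefix_mkseq.
Qed.

Lemma img_size_mono t : size (img t [:: a]) <= size (img t.+1 [:: a]).
Proof. by have [w E] := g_a; rewrite imgS1 E (img_cons _ t a w) size_cat leq_addr. Qed.

(** The delicate case is [x = a] at the very beginning of [u], where part of the image of [a] itself
    is subtracted. There [y], outside [Z1], stops the trailing block before it reaches [img t
    [:: a]], at the cost of one step in [t]. *)
Lemma gap_start_ge m al x v y be t : gap m al x v y be -> 0 < t ->
  size (img t [:: a]) <= gap_start g Z t.+1 (mkseq u m) al x.
Proof.
move=> [E Zx Zy Zv] t0; rewrite /gap_start !img_cat !size_cat.
have u0 : u 0 = a by have := u_pref 0 => /= -[].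
have ts := trail_size Z (img t.+1 [:: x]); have mono := img_size_mono t.
case: m E => [|m] E.
  rewrite u0 in E; case: al E => [|b al] E; last first.
    have [w Ea] := g_a; rewrite Ea in E; case: E => <- _.
    rewrite (img_cons g t.+1 a al) size_cat; lia.
  have [w Ea] := g_a; have ax : x = a by move: E; rewrite Ea => -[].
  rewrite ax in E *; rewrite cat0s in E.
  have /and4P[_ k1 k2 k3] : [&& a < k, all below v, y < k & all below be].
    by have := g_lt a_lt; rewrite E /= all_cat.
  have -> : img t.+1 [:: a] = (img t [:: a] ++ img t v) ++ (img t [:: y] ++ img t be).
    by rewrite imgS1 E (img_cons g t a) img_cat (img_cons g t y) catA.
  rewrite trail_cat_has; last by rewrite all_cat all_Z_img //= ?k2 // (negPf Zy).
  have := trail_size Z (img t [:: y] ++ img t be); rewrite !size_cat /=; lia.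
have -> : ext g (mkseq u m.+1) = g a ++ ext g [seq u i | i <- iota 1 m].
  by rewrite /mkseq /= u0.
rewrite img_cat size_cat -imgS1.
have := img_size_mono t.+1; lia.
Qed.

(** Bounds the positions [m] at which gaps must be considered, leaving finitely many of them. *)
Lemma letters_occur_early : exists N, forall n, u n \in mkseq u N.
Proof.
suff : forall j, exists N, forall n, u n < j -> u n \in mkseq u N.
  by move=> /(_ k) [N HN]; exists N => n; apply: HN; exact: u_lt.
elim=> [|j [N HN]]; first by exists 0.
have mk n p : n < p -> u n \in mkseq u p by move=> np; apply/mapP; exists n; rewrite ?mem_iota.
have sub N' n : N <= N' -> u n < j -> u n \in mkseq u N'.
  move=> NN /HN /mapP[i]; rewrite mem_iota /= add0n => iN ->; apply: mk; exact: leq_trans NN.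
have [[n0 E]|nex] := classic (exists n, u n = j).
  exists (maxn N n0.+1) => n; rewrite ltnS leq_eqVlt => /orP[/eqP->|]; last by apply: sub; lia.
  by rewrite -E; apply: mk; lia.
exists N => n; rewrite ltnS leq_eqVlt => /orP[/eqP E|]; last exact: HN.
by case: nex; exists n.
Qed.

Lemma sum_count (F : nat -> nat) w : all below w ->
  \sum_(c <- w) F c = \sum_(d < k) count_mem (d : nat) w * F d.
Proof.
elim: w => [_|c w IH /= /andP[ck /IH IHw]]; first by rewrite big_nil big1.
rewrite big_cons IHw; under [RHS]eq_bigr do rewrite mulnDl.
rewrite big_split /=; congr (_ + _).
rewrite (bigD1 (Ordinal ck)) //= eqxx mul1n big1 ?addn0 // => i.
by rewrite -val_eqE /= eq_sym => /negPf->.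
Qed.

Lemma size_img_sum t w : size (img t w) = \sum_(c <- w) size (img t [:: c]).
Proof.
elim: w => [|c w IH]; first by rewrite img_nil big_nil.
by rewrite img_cons size_cat IH big_cons.
Qed.

Lemma size_img_bound : exists K, forall t s w, all below w ->
  size (img (s + t) w) <= K ^ s * size (img t w).
Proof.
exists (\sum_(d < k) size (g d)) => t s w wk.
elim: s => [|s IH]; first by rewrite mul1n.
rewrite expnS -mulnA (leq_trans _ (leq_mul (leqnn _) IH)) // addSn /=.
move: (img (s + t) w) (img_below (s + t) wk) => r; elim: r => [|c r IHr]; first by rewrite muln0.
rewrite -cat1s ext_cat ext1 size_cat /= mulnS => /andP[ck /IHr h]; rewrite leq_add //.
by rewrite (bigD1 (Ordinal ck)) //= leq_addr.
Qed.

(* The shift by 2 is needed because the recurrences for [lead] and [trail] start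
   at [t = 1] and [gap_start_ge] loses one more step. *)
Definition is_gap_ratio (P : R -> Prop) q s := forall m al x v y be, gap m al x v y be ->
  exists r, P r /\ Un_cv (fun t => Rdiv (INR (gap_size g Z (q * t + s).+2 x v y))
    (INR (gap_start g Z (q * t + s).+2 (mkseq u m) al x))) r.

(** Word lengths and the recurrences for [lead] and [trail] form one nonnegative linear system, in
    which sizes and starts of gaps are linear forms. *)
Theorem gap_ratio_algebraic :
  exists q, 0 < q /\ forall s, is_gap_ratio is_algebraic q s.
Proof.
have [N HN] := letters_occur_early.
pose occ c := c \in mkseq u N.
have occP c : occ c -> exists n, u n = c by case/mapP=> n _ ->; exists n.
have uocc n : occ (u n) by exact: HN.
have occ_lt c : occ c -> c < k by case/occP=> n <-; exact: u_lt.
have pref_occ w : isprefix u w -> all occ w.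
  by move=> ->; apply/allP=> d /mapP[n _ ->]; exact: uocc.
have occ_g c : occ c -> all occ (g c).
  case/occP=> n <-; have := pref_occ _ (isprefix_img u_pref img_grow 1 (isprefix_occ n)).
  by rewrite /img /= -cats1 ext_cat ext1 all_cat => /andP[].
have occ_below w : all occ w -> all below w by apply: sub_all => c /occ_lt.
(* The coordinates are [|g^t c|], [trail (g^t x)] and [lead (g^t y)]; they are set
   to 0 for letters absent from [u], so that [|g^t a|] dominates the matrix. *)
pose J := ('I_k + ('I_k + 'I_k))%type.
pose live (x : nat) := occ x && ~~ Z1 x.
pose M (i j : J) : nat := match i, j with
  | inl c, inl d => if occ c then count_mem (d : nat) (g c) else 0
  | inl _, inr _ => 0
  | inr (inl x), inl d => if live x then count_mem (d : nat) (rev (sfx x)) else 0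
  | inr (inl x), inr (inl x') => live x && (prv x == x')
  | inr (inl x), inr (inr _) => 0
  | inr (inr y), inl d => if live y then count_mem (d : nat) (pfx y) else 0
  | inr (inr y), inr (inl _) => 0
  | inr (inr y), inr (inr y') => live y && (nxt y == y')
  end.
pose FX t d := if occ d then size (img t.+2 [:: d]) else 0.
pose TX t d := if live d then trail Z (img t.+2 [:: d]) else 0.
pose LX t d := if live d then lead Z (img t.+2 [:: d]) else 0.
pose X t (i : J) : nat := match i with
  inl c => FX t c | inr (inl x) => TX t x | inr (inr y) => LX t y end.
(* [Y] replaces [lead] and [trail] by full image lengths, for which the recurrences become
   inequalities; the value [1] elsewhere keeps [Y 0] positive. *)
pose FY t d := if occ d then size (img t [:: d]) else 1.
pose GY t d := if live d then size (img t [:: d]) else 1.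
pose Y t (i : J) : nat := match i with
  inl c => FY t c | inr (inl x) => GY t x | inr (inr y) => GY t y end.
have sumJ (F : J -> nat) : \sum_j F j =
    \sum_(d < k) F (inl d) + (\sum_(d < k) F (inr (inl d)) + \sum_(d < k) F (inr (inr d))).
  by rewrite !big_sumType.
have sum_indicator (b : bool) (z : nat) (F : nat -> nat) : z < k ->
    \sum_(d < k) (b && (z == d)) * F d = if b then F z else 0.
  move=> zk; case: b => /=; last by rewrite big1.
  rewrite (bigD1 (Ordinal zk)) //= eqxx mul1n big1 ?addn0 // => i.
  by rewrite -val_eqE /= eq_sym => /negPf->.
have sum_word (b : bool) (F : nat -> nat) w : all below w ->
    \sum_(d < k) (if b then count_mem (d : nat) w else 0) * F d = if b then \sum_(c <- w) F c else 0.
  by case: b => wk; [rewrite sum_count | rewrite big1].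
have sum0 (F : nat -> nat) : \sum_(d < k) 0 * F d = 0 by rewrite big1.
have sfx_occ x : live x -> all occ (rev (sfx x)) && occ (prv x).
  case/andP=> ox Zx; have [al [E _ _]] := prvE (occ_lt _ ox) Zx.
  by have := occ_g _ ox; rewrite E all_cat /= => /and3P[_ -> ->].
have pfx_occ y : live y -> all occ (pfx y) && occ (nxt y).
  case/andP=> oy Zy; have [be [E _ _]] := nxtE (occ_lt _ oy) Zy.
  by have := occ_g _ oy; rewrite E all_cat /= => /and3P[-> -> _].
have occ_a : occ a by have := u_pref 0 => /= -[<-]; exact: uocc.
have sum_FX t w : all occ w -> \sum_(c <- w) FX t c = size (img t.+2 w).
  by move=> /allP ow; rewrite size_img_sum; apply: eq_big_seq => c /ow; rewrite /FX => ->.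
have sum_FY t w : all occ w -> \sum_(c <- w) FY t c = size (img t w).
  by move=> /allP ow; rewrite size_img_sum; apply: eq_big_seq => c /ow; rewrite /FY => ->.
have live_lt x : live x -> x < k by case/andP=> /occ_lt.
have [K HK] := size_img_bound.
(* An occurring letter appears in [img N [:: a]], so its images are no longer than those of that
   word, which exceed the images of [a] by a factor of at most [K ^ N]. *)
have Yle t c : occ c -> size (img t [:: c]) <= K ^ N * size (img t.+2 [:: a]).
  move=> oc; have cin : c \in img N [:: a].
    move: oc => /mapP[n]; rewrite mem_iota add0n => /= nN ->.
    rewrite -u_pref; apply/mapP; exists n => //; rewrite mem_iota add0n /=.
    exact: ltn_trans (img_grow N).
  have [w1 [w2 E]] : exists w1 w2, img N [:: a] = w1 ++ c :: w2.
    by case/path.splitPr: cin => w1 w2; exists w1, w2.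
  apply: (@leq_trans (size (img (N + t) [:: a]))).
    by rewrite addnC imgD E img_cat (img_cons g t c w2) !size_cat addnCA leq_addr.
  apply: leq_trans (HK t N [:: a] _) _; first by rewrite /= a_lt.
  rewrite leq_mul2l; apply/orP; right.
  exact: leq_trans (img_size_mono _) (img_size_mono _).
have [||||||q [q0 Hq]] := @linear_form_ratio J M X Y (inl (Ordinal a_lt)) (K ^ N).
- move=> t [c|[x|y]]; rewrite sumJ /= ?sum0 ?addn0.
  + rewrite (sum_word _ (FX t)) ?g_lt // /FX.
    by case: ifP => // oc; rewrite sum_FX ?occ_g // imgS1.
  + have [lx|nl] := boolP (live x); last by rewrite /TX (negPf nl) !big1.
    have /andP[os op] := sfx_occ _ lx; have /andP[ox Zx] := lx.
    rewrite (sum_word true (FX t)) ?occ_below // (sum_indicator true _ (TX t)) ?occ_lt //.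
    rewrite sum_FX // /TX lx; have [al [_ _ Zp]] := prvE (live_lt _ lx) Zx.
    by rewrite /live op Zp trail_rec // live_lt.
  + have [ly|nl] := boolP (live y); last by rewrite /LX (negPf nl) !big1.
    have /andP[os op] := pfx_occ _ ly; have /andP[oy Zy] := ly.
    rewrite (sum_word true (FX t)) ?occ_below // (sum_indicator true _ (LX t)) ?occ_lt //.
    rewrite sum_FX // /LX ly; have [be [_ _ Zn]] := nxtE (live_lt _ ly) Zy.
    by rewrite /live op Zn lead_rec // live_lt.
- by move=> [c|[x|y]] /=; rewrite /FY /GY; case: ifP.
- move=> t [c|[x|y]]; rewrite sumJ /= ?sum0 ?addn0.
  + rewrite (sum_word _ (FY t)) ?g_lt // /FY.
    by case: ifP => // oc; rewrite sum_FY ?occ_g // imgS1.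
  + have [lx|nl] := boolP (live x); last by rewrite !big1.
    have /andP[os op] := sfx_occ _ lx; have /andP[ox Zx] := lx.
    rewrite (sum_word true (FY t)) ?occ_below // (sum_indicator true _ (GY t)) ?occ_lt //.
    rewrite sum_FY // /GY lx; have [al [E _ Zp]] := prvE (live_lt _ lx) Zx.
    by rewrite /live op Zp imgS1 E img_cat (img_cons g t (prv x) (rev (sfx x))) !size_cat
      [size (img t [:: prv x]) + _]addnC leq_addl.
  + have [ly|nl] := boolP (live y); last by rewrite !big1.
    have /andP[os op] := pfx_occ _ ly; have /andP[oy Zy] := ly.
    rewrite (sum_word true (FY t)) ?occ_below // (sum_indicator true _ (GY t)) ?occ_lt //.
    rewrite sum_FY // /GY ly; have [be [E _ Zn]] := nxtE (live_lt _ ly) Zy.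
    by rewrite /live op Zn imgS1 E img_cat (img_cons g t (nxt y) be) !size_cat leq_add2l leq_addr.
- have K0 t : 0 < K ^ N * size (img t.+2 [:: a]).
    by apply: leq_trans (Yle t a occ_a); exact: leq_trans (img_grow t).
  move=> t [c|[x|y]] /=; rewrite /FX /FY /GY occ_a; case: ifP => // h;
    by apply: Yle => //; case/andP: h.
- by move=> t; rewrite /= /FX occ_a; exact: img_size_mono.
- by rewrite /= /FX occ_a; exact: leq_trans (img_grow _).
exists q; split=> // s m al x v y be gapm.
have lf_nat f (be' : J -> nat) : (forall t, f t = \sum_j be' j * X t j) -> linear_form X f.
  move=> H; exists (fun j => (be' j)%:Z)%R => t; rewrite H -natz GRing.natr_sum.
  by apply: eq_bigr => j _; rewrite natz PoszM.
have lf_add f h : linear_form X f -> linear_form X h -> linear_form X (fun t => f t + h t).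
  case=> al1 H1 [al2 H2]; exists (fun j => al1 j + al2 j)%R => t; rewrite PoszD H1 H2.
  by rewrite -big_split /=; apply: eq_bigr => j _; rewrite GRing.mulrDl.
have lf_sub f h : (forall t, h t <= f t) -> linear_form X f -> linear_form X h ->
    linear_form X (fun t => f t - h t).
  move=> le [al1 H1] [al2 H2]; exists (fun j => al1 j - al2 j)%R => t.
  rewrite -subzn // H1 H2 -GRing.sumrB.
  by apply: eq_bigr => j _; rewrite GRing.mulrBl.
have lf_word w : all occ w -> linear_form X (fun t => size (img t.+2 w)).
  move=> ow; apply: (lf_nat _ (fun j => if j is inl c then count_mem (c : nat) w else 0)) => t.
  by rewrite sumJ /= !sum0 !addn0 -sum_FX // (sum_count _ (occ_below _ ow)) //.
have [E Zx Zy Zv] := gapm.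
have := occ_g _ (uocc m); rewrite E all_cat /= all_cat /= => /and5P[oal ox ov oy _].
have lf_trail : linear_form X (fun t => trail Z (img t.+2 [:: x])).
  apply: (lf_nat _ (fun j => if j is inr (inl x') then (true && (x == x')) : nat else 0)) => t.
  rewrite sumJ /= !sum0 (sum_indicator true x (TX t)) ?occ_lt //.
  by rewrite /TX /live ox Zx addn0.
have lf_lead : linear_form X (fun t => lead Z (img t.+2 [:: y])).
  apply: (lf_nat _ (fun j => if j is inr (inr y') then (true && (y == y')) : nat else 0)) => t.
  rewrite sumJ /= !sum0 (sum_indicator true y (LX t)) ?occ_lt //.
  by rewrite /LX /live oy Zy.
apply: (Hq s (fun t => gap_size g Z t.+2 x v y) (fun t => gap_start g Z t.+2 (mkseq u m) al x) K).
- by apply: (lf_add _ _ _ lf_lead); apply: (lf_add _ _ lf_trail); exact: lf_word.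
- rewrite /gap_start; apply: lf_sub => //.
    by move=> t; rewrite !img_cat !size_cat; have := trail_size Z (img t.+2 [:: x]); lia.
  apply: lf_word; rewrite !all_cat oal /= ox.
  have := pref_occ _ (isprefix_img u_pref img_grow 1 (isprefix_occ m)).
  by rewrite /img /= -cats1 ext_cat all_cat => /andP[-> _].
(* [gap_start_ge] is one step behind [X]; that step costs the factor [K]. *)
move=> t; rewrite /= /FX occ_a.
have := gap_start_ge gapm (ltn0Sn t); have := HK t.+1 1 [:: a]; rewrite /= a_lt expn1 => /(_ isT) h1 h2.
by apply: leq_trans h1 _; rewrite leq_mul2l h2 orbT.
Qed.
Lemma gap_letters m al x v y be : gap m al x v y be ->
  [&& all below al, x < k, all below v, y < k & all below be].
Proof. by case=> E _ _ _; have := g_lt (u_lt m); rewrite E all_cat /= all_cat. Qed.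

(** For uniform [g] the increments of [lead] and [trail] are [K^t] times a word length, so
    [geometric_recurrence] applies. *)
Theorem gap_ratio_rational K : 1 < K -> (forall c, c < k -> size (g c) = K) ->
  is_gap_ratio is_rational 1 0.
Proof.
move=> K1 unif m al x v y be gapm.
have powE n : PeanoNat.Nat.pow K n = K ^ n by elim: n => //= n ->; rewrite expnS.
have size_img t w : all below w -> size (img t w) = K ^ t * size w.
  elim: t w => [|t IH] w wk; first by rewrite mul1n.
  rewrite imgSr IH; last by apply: (@img_below 1).
  rewrite expnSr -mulnA; congr (_ * _).
  elim: w wk => [|c w IHw] /=; first by rewrite muln0.
  by case/andP=> ck /IHw h; rewrite -cat1s ext_cat ext1 size_cat unif // h mulnS.
pose good x := (x < k) && ~~ Z1 x.
have good_lt z : good z -> z < k by case/andP.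
have [E Zx Zy Zv] := gapm; have /and5P[kal kx kv ky kbe] := gap_letters gapm.
have [r1 H1] : exists r, geometric K (fun t => trail Z (img t [:: x])) r.
  apply: (@geometric_recurrence K k good prv (fun z => size (sfx z)) (fun t z => trail Z (img t [:: z]))) => //.
  - move=> z /andP[zk Zz]; have [al' [Ez _ Zp]] := prvE zk Zz.
    by rewrite /good Zp andbT; have := g_lt zk; rewrite Ez all_cat /= => /and3P[].
  - move=> t z t0 /andP[zk Zz]; rewrite trail_rec // size_img ?size_rev //.
    by have [al' [Ez _ _]] := prvE zk Zz; have := g_lt zk; rewrite Ez all_cat /= => /and3P[].
  - by rewrite /good kx.
have [r2 H2] : exists r, geometric K (fun t => lead Z (img t [:: y])) r.
  apply: (@geometric_recurrence K k good nxt (fun z => size (pfx z)) (fun t z => lead Z (img t [:: z]))) => //.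
  - move=> z /andP[zk Zz]; have [be' [Ez _ Zp]] := nxtE zk Zz.
    by rewrite /good Zp andbT; have := g_lt zk; rewrite Ez all_cat /= => /and3P[].
  - move=> t z t0 /andP[zk Zz]; rewrite lead_rec // size_img //.
    by have [be' [Ez _ _]] := nxtE zk Zz; have := g_lt zk; rewrite Ez all_cat /= => /and3P[].
  - by rewrite /good ky.
have kW : all below (ext g (mkseq u m) ++ al ++ [:: x]).
  rewrite !all_cat kal /= kx !andbT; apply: (@img_below 1).
  by apply/allP=> z /mapP[n _ ->]; exact: u_lt.
have [l [Ql Hl]] : exists l, is_rational l /\ Un_cv (fun t => Rdiv (INR (gap_size g Z t.+2 x v y))
    (INR (gap_start g Z t.+2 (mkseq u m) al x))) l.
  have Hv : geometric K (fun t => size (img t v)) (INR (size v)).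
    by apply: geometric_exact => t; rewrite size_img // powE.
  have HW : geometric K (fun t => size (img t (ext g (mkseq u m) ++ al ++ [:: x])))
      (INR (size (ext g (mkseq u m) ++ al ++ [:: x]))).
    by apply: geometric_exact => t; rewrite size_img // powE.
  apply: (@geometric_ratio K (ltP K1) (fun t => gap_size g Z t x v y)
    (fun t => gap_start g Z t (mkseq u m) al x) _ _
    (geometric_plus _ _ _ _ _ (geometric_plus _ _ _ _ _ H1 Hv) H2)
    (geometric_minus _ _ _ _ _ _ HW H1)).
  - move=> t; apply/leP; rewrite !img_cat !size_cat; have := trail_size Z (img t [:: x]).
    by move/leq_trans; apply; rewrite addnA leq_addl.
  - move=> t /ltP t0; apply/leP; rewrite powE.
    apply: leq_trans (gap_start_ge gapm t0).
    by rewrite size_img /= ?a_lt // muln1.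
exists l; split=> // eps /Hl [T HT]; exists T => t /HT.
by rewrite mul1n addn0.
Qed.

Hypothesis Z_inf : forall n, exists2 m, n <= m & ~~ Z (u m).

Lemma In_map (T : eqType) (S : Type) (f : T -> S) (s : seq T) p :
  List.In p (map f s) <-> exists2 i, i \in s & p = f i.
Proof.
elim: s => [|c s IH] /=; first by split=> // -[].
rewrite IH; split=> [[<-|[i si ->]]|[i]].
- by exists c; rewrite ?mem_head.
- by exists i; rewrite // inE si orbT.
- by rewrite inE => /orP[/eqP->|si] ->; [left | right; exists i].
Qed.

(** A family is coded by the position [m < N] of a letter, the places of [x] and [y] in its image,
    and the residue of [t] modulo [q]; only codes of actual gaps are kept. *)
Theorem run_family (P : R -> Prop) q : 0 < q -> (forall s, s < q -> is_gap_ratio P q s) ->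
  gap_ratios_in P u Z.
Proof.
move=> q0 Hlim.
have [N HN] := letters_occur_early.
pose B := \sum_(m < N) size (g (u m)).
pose idx := ('I_N * 'I_B * 'I_B * 'I_q)%type.
pose al (i : idx) := take i.1.1.2 (g (u i.1.1.1)).
pose x (i : idx) := nth 0 (g (u i.1.1.1)) i.1.1.2.
pose rest (i : idx) := drop (i.1.1.2).+1 (g (u i.1.1.1)).
pose v (i : idx) := take i.1.2 (rest i).
pose y (i : idx) := nth 0 (rest i) i.1.2.
pose be (i : idx) := drop (i.1.2).+1 (rest i).
pose valid (i : idx) := [&& g (u i.1.1.1) == al i ++ x i :: v i ++ y i :: be i,
  ~~ Z1 (x i), ~~ Z1 (y i) & all Z1 (v i)].
have validP i : valid i -> gap i.1.1.1 (al i) (x i) (v i) (y i) (be i).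
  by case/and4P=> /eqP.
pose D (i : idx) t := gap_size g Z (q * t + i.2).+2 (x i) (v i) (y i).
pose I (i : idx) t := gap_start g Z (q * t + i.2).+2 (mkseq u i.1.1.1) (al i) (x i).
exists (map (fun i => (D i, I i)) (filter valid (enum {: idx}))).
have inG D' I' : List.In (D', I') (map (fun i => (D i, I i)) (filter valid (enum {: idx}))) ->
    exists2 i, valid i & D' = D i /\ I' = I i.
  by case/In_map => i; rewrite mem_filter => /andP[vi _] [-> ->]; exists i.
split.
- move=> D' I' /inG [i /validP gi [-> ->]].
  exact: (Hlim _ (ltn_ord i.2) _ _ _ _ _ _ gi).
- move=> D' I' /inG [i /validP gi [_ ->]] n; exists n => t nt.
  have := gap_start_ge gi (ltn0Sn (q * t + i.2)).
  apply: leq_trans; apply: leq_trans (ltnW (img_grow _)).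
  apply: leq_trans nt _; apply: leqW; apply: leq_trans (leq_addr _ _).
  by rewrite leq_pmull.
- move=> D' I' /inG [i /validP gi [-> ->]] t; have [E Zx Zy Zv] := gi.
  apply: (gap_is_run u_pref img_grow (isprefix_occ i.1.1.1) E).
  rewrite all_Z_img //.
  by have /and5P[] := gap_letters gi.
move=> T; have [K1 HK1] := run_covered u_pref img_grow Z_inf.
have [K2 HK2] := size_img_bound.
(* Runs from exponents [t < q * T + 2] are bounded by [K2 ^ t.+1], whence the sum; all other [t]
   have [(t - 2) %/ q >= T]. *)
exists (K1 + \sum_(t < q * T + 2) K2 ^ t.+1) => i l /HK1 [le|].
  by left; exact: leq_trans le (leq_addr _ _).
case=> t [P0 [c [al' [x' [v' [y' [be' [Pc E /and3P[Zx Zy Zv] hi hl]]]]]]]].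
have Pnth : u (size P0) = c by apply: (isprefix_nth (w2 := [::])); rewrite cats1.
have ck : c < k by rewrite -Pnth u_lt.
have := g_lt ck; rewrite E all_cat /= all_cat /= => /and5P[k1 k2 k3 k4 k5].
have [tT|Tt] := ltnP t (q * T + 2).
  left; apply: leq_trans hl _.
  apply: (@leq_trans (size (img t.+1 [:: c]))).
    rewrite imgS1 E img_cat (img_cons g t x' (v' ++ y' :: be')) img_cat (img_cons g t y' be') !size_cat.
    rewrite /gap_size.
    have := trail_size Z (img t [:: x']); have := lead_size Z (img t [:: y']); lia.
  apply: leq_trans (_ : K2 ^ t.+1 <= _).
    by have := HK2 0 t.+1 [:: c]; rewrite /= ck addn0 muln1; apply.
  by rewrite (bigD1 (Ordinal tT)) //=; lia.
right.
have t0 : 0 < t by lia.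
have Zx1 : ~~ Z1 x' by move: Zx; rewrite (Z_stable k2 t0).
have Zy1 : ~~ Z1 y' by move: Zy; rewrite (Z_stable k4 t0).
have Zv1 : all Z1 v' by rewrite -(all_Z_img t0).
(* Moving to an earlier occurrence of [c] can only lower the start, and the length does not depend
   on the prefix. *)
have [m [mN mP um]] : exists m, [/\ m < N, m <= size P0 & u m = c].
  have [lt|le] := ltnP (size P0) N; first by exists (size P0).
  have /mapP[m] := HN (size P0); rewrite mem_iota /= add0n => mN.
  by rewrite Pnth => ->; exists m; rewrite mN (leq_trans (ltnW mN)).
have sB : size (g (u m)) <= B by rewrite /B (bigD1 (Ordinal mN)) //= leq_addr.
have sE : size (g (u m)) = size al' + (size v' + (size be').+1).+1.
  by rewrite um E size_cat /= size_cat.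
have eB : size al' < B by lia.
have fB : size v' < B by lia.
have sq : (t - 2) %% q < q by rewrite ltn_mod.
pose j : idx := (Ordinal mN, Ordinal eB, Ordinal fB, Ordinal sq).
have Et : t = (q * ((t - 2) %/ q) + (t - 2) %% q).+2 by have := divn_eq (t - 2) q; lia.
have jal : al j = al' by rewrite /al /= um E take_size_cat.
have jx : x j = x' by rewrite /x /= um E nth_cat ltnn subnn.
have jr : rest j = v' ++ y' :: be'.
  by rewrite /rest /= um E -cat_rcons drop_size_cat // size_rcons.
have jv : v j = v' by rewrite /v jr /= take_size_cat.
have jy : y j = y' by rewrite /y jr /= nth_cat ltnn subnn.
have jbe : be j = be' by rewrite /be jr /= -cat_rcons drop_size_cat // size_rcons.
exists (D j), (I j), ((t - 2) %/ q); split.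
  apply/In_map; exists j => //; rewrite mem_filter mem_enum andbT /valid jal jx jv jy jbe.
  by rewrite /= um E eqxx Zx1 Zy1.
split.
- by rewrite leq_divRL // mulnC; lia.
- rewrite /I /= jal jx -Et; apply: leq_trans hi; rewrite /gap_start leq_sub2r //.
  rewrite !img_cat !size_cat leq_add2r.
  have -> : P0 = mkseq u m ++ [seq u n | n <- iota m (size P0 - m)].
    have := isprefix_catl (w1 := P0) (w2 := [:: c]); rewrite cats1 => /(_ _ Pc) {1}->.
    by rewrite /mkseq -{1}(subnKC mP) iotaD map_cat.
  by rewrite ext_cat img_cat size_cat leq_addr.
- by rewrite /D /= jx jv jy -Et.
Qed.
End Stable.

Lemma morph_ext h w : morph h w = ext h w.
Proof. by rewrite /morph /ext; elim: w => //= c w ->. Qed.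

Lemma iter_morph h t w : Nat.iter t (morph h) w = img h t w.
Proof. by elim: t => //= t ->; rewrite morph_ext. Qed.

Lemma nth_nthE (w : seq nat) i : List.nth i w 0 = nth 0 w i.
Proof. by elim: w i => [|c w IH] [|i] //=. Qed.

(** * Passing to a power of the morphism *)

Section Reduction.
Variables (k : nat) (h : nat -> seq nat) (u : nat -> nat) (a : nat).
Hypothesis h_morphism : is_morphism k h.
Hypothesis a_lt : a < k.
Hypothesis u_fixed : is_fixed_point_word h a u.

Lemma morphism_below c : c < k -> all (fun d => d < k) (h c).
Proof.
move=> /ltP ck; have := h_morphism ck; elim: (h c) => //= d w IH H.
by rewrite IH => [|y wy]; rewrite ?andbT; [apply/ltP; apply: H; left | apply: H; right].
Qed.

Lemma img_h_below t w : all (fun d => d < k) w -> all (fun d => d < k) (img h t w).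
Proof. exact: img_below morphism_below t w. Qed.

Lemma fixed_point_pref n : mkseq u (size (img h n [:: a])) = img h n [:: a].
Proof.
have [_ Hu] := u_fixed; apply: (@eq_from_nth _ 0); first by rewrite size_mkseq.
move=> i; rewrite size_mkseq => lt; rewrite nth_mkseq //.
have := Hu n i; rewrite iter_morph nth_nthE; apply.
by apply/ltP; move: lt; congr (_ < _); elim: (img h n _) => //= c w ->.
Qed.

Lemma prolongable_cons : exists2 x, h a = a :: x & forall n, img h n x <> [::].
Proof.
by have [[x [E [_ Hx]]] _] := u_fixed; exists x => // n; rewrite -iter_morph; exact: Hx.
Qed.

Lemma prolongable_grow n : n < size (img h n [:: a]).
Proof.
have [x E Hx] := prolongable_cons; elim: n => // n IH.
rewrite imgS1 E (img_cons h n a x) size_cat.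
by have := Hx n; case: (img h n x) => //= c w _; lia.
Qed.

Lemma img_h_cons n : exists w, img h n [:: a] = a :: w.
Proof.
have [x E _] := prolongable_cons; elim: n => [|n [w Ew]]; first by exists [::].
by rewrite imgS1 E (img_cons h n a x) Ew; eexists.
Qed.

(** The set of letters sent into [Z^*] by [h^t] determines the one for [h^(t+1)], so
    [iter_idempotent] applies to the sequence of these sets. *)
Lemma stable_power (Z : pred nat) : exists2 q, 0 < q &
  forall c t, c < k -> 0 < t -> all Z (img h (q * t) [:: c]) = all Z (img h q [:: c]).
Proof.
pose pat t : {ffun 'I_k -> bool} := [ffun c : 'I_k => all Z (img h t [:: (c : nat)])].
pose F (p : {ffun 'I_k -> bool}) : {ffun 'I_k -> bool} :=
  [ffun c : 'I_k => [forall d : 'I_k, ((d : nat) \in h c) ==> p d]].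
have pF t : pat t = iter t F (pat 0).
  elim: t => // t IH; rewrite iterS -IH; apply/ffunP=> c; rewrite !ffunE imgS1.
  have := morphism_below (ltn_ord c); elim: (h c) => [_|d w IHw /= /andP[dk /IHw {}IHw]].
    by rewrite img_nil; apply/esym/forallP.
  rewrite (img_cons h t d w) all_cat IHw; apply/andP/forallP => [[Zd /forallP H] e|H].
    by rewrite inE; apply/implyP=> /orP[/eqP ed|]; [rewrite ffunE ed | exact: (implyP (H e))].
  split; first by have := H (Ordinal dk); rewrite inE eqxx ffunE.
  by apply/forallP=> e; apply/implyP=> ew; have := H e; rewrite inE ew orbT.
have [q q0 Hq] := iter_idempotent F (pat 0).
exists q => // c t ck t0; have := Hq t t0; rewrite -!pF => /ffunP /(_ (Ordinal ck)).
by rewrite !ffunE.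
Qed.

(** Take [g] to be the [q]-th power of [h] from [stable_power], which has the same fixed point. In
    the uniform case [K = L ^ q], and [L > 1] since [h a] has at least two letters. *)
Lemma stable_morphism (Z : pred nat) : exists g : nat -> seq nat,
  [/\ [/\ forall c, c < k -> all (fun d => d < k) (g c),
          forall n, mkseq u (size (img g n [:: a])) = img g n [:: a],
          forall n, n < size (img g n [:: a]) &
          exists w, g a = a :: w],
      forall c t, c < k -> 0 < t -> all Z (img g t [:: c]) = all Z (g c) &
      uniform k h -> exists2 K, 1 < K & forall c, c < k -> size (g c) = K].
Proof.
have [q q0 Hq] := stable_power Z.
pose g c := img h q [:: c].
have extE w : ext g w = img h q w.
  elim: w => [|c w IH]; first by rewrite img_nil.
  by rewrite -cat1s ext_cat ext1 img_cat IH.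
have imgE t w : img g t w = img h (q * t) w.
  elim: t => [|t IH]; first by rewrite muln0.
  by rewrite -[LHS]/(ext g (img g t w)) extE IH -imgD -mulnS.
exists g; split; first split.
- by move=> c ck; apply: img_h_below; rewrite /= ck.
- by move=> n; rewrite imgE fixed_point_pref.
- move=> n; rewrite imgE; apply: leq_ltn_trans (prolongable_grow _).
  by rewrite leq_pmull.
- exact: img_h_cons.
- by move=> c t ck t0; rewrite imgE Hq.
case=> L HL.
have size_h c : c < k -> size (h c) = L.
  by move=> /ltP /HL <-; elim: (h c) => //= d w ->.
have size_img t w : all (fun d => d < k) w -> size (img h t w) = L ^ t * size w.
  elim: t w => [|t IH] w wk; first by rewrite mul1n.
  rewrite imgSr IH; last by apply: (img_h_below 1).
  rewrite expnSr -mulnA; congr (_ * _).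
  elim: w wk => [|c w IHw] /=; first by rewrite muln0.
  by case/andP=> ck /IHw e; rewrite -cat1s ext_cat ext1 size_cat size_h // e mulnS.
have L1 : 1 < L.
  by have := prolongable_grow 1; rewrite size_img /= ?a_lt // muln1 expn1.
exists (L ^ q); last by move=> c ck; rewrite size_img /= ?ck // muln1.
by rewrite -{1}(exp1n q) ltn_exp2r.
Qed.

End Reduction.

(** * From runs of the two extreme digits to the exponent *)

Section Words.
Variables (xi : R) (b : nat) (d : nat -> nat).
Hypothesis xi_irrational : ~ is_rational xi.
Hypothesis b_ge2 : (2 <= b)%coq_nat.
Hypothesis d_exp : is_base_expansion b xi d.

(** For the digit [0] this comes from irrationality, for [b - 1] from the normalization of the
    expansion. *)
Lemma digit_not_cofinite (u tau : nat -> nat) c : (forall n, d n = tau (u n)) ->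
  c = 0 \/ c = b - 1 -> forall n, exists2 m, n <= m & ~~ (tau (u m) == c).
Proof.
move=> du [->|->] n.
  have [m [/leP nm dm]] := zero_digits_not_cofinite _ _ _ xi_irrational b_ge2 d_exp n.
  by exists m => //; apply/eqP; rewrite -du.
have [m [/leP nm dm]] := top_digits_not_cofinite _ _ _ d_exp n.
by exists m => //; apply/eqP; rewrite -du.
Qed.

Lemma vb_of_gap_ratios (P : R -> Prop) (u tau : nat -> nat) : P R0 -> (forall n, d n = tau (u n)) ->
  (forall c, c = 0 \/ c = b - 1 -> gap_ratios_in P u (fun x => tau x == c)) ->
  exists r, vb_equals b xi r /\ P r.
Proof.
move=> P0 du HG.
have runE c i l : is_run u (fun x => tau x == c) i l <-> constant_run d c i l.
  split=> H n; first by case=> /leP h1 /leP h2; rewrite du; apply/eqP/H; rewrite h1 h2.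
  by case/andP=> /leP h1 /leP h2; apply/eqP; rewrite -du; apply: H.
have [G0 [lim0 inf0 run0 cov0]] := HG 0 (or_introl erefl).
have [G1 [lim1 inf1 run1 cov1]] := HG (b - 1) (or_intror erefl).
apply: (vb_of_runs _ _ _ xi_irrational b_ge2 d_exp P P0 (G0 ++ G1)%list).
- by move=> D I /(@List.in_app_or _ _ _ _) [/lim0|/lim1].
- move=> D I /(@List.in_app_or _ _ _ _) [/inf0|/inf1] H N; have [T HT] := H N; exists T => t /leP /HT /leP //.
- move=> D I /(@List.in_app_or _ _ _ _) [/run0|/run1] H t; [left | right]; exact: (proj1 (runE _ _ _)) (H t).
move=> T; have [K0 H0] := cov0 T; have [K1 H1] := cov1 T.
exists (K0 + K1) => i l [/(proj2 (runE _ _ _))/H0|/(proj2 (runE _ _ _))/H1] [le|[D [I [t [DI [/leP tT /leP It /leP lD]]]]]].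
- by left; apply/leP; exact: leq_trans le (leq_addr _ _).
- by right; exists D, I, t; split; first by apply/List.in_or_app; left.
- by left; apply/leP; exact: leq_trans le (leq_addl _ _).
- by right; exists D, I, t; split; first by apply/List.in_or_app; right.
Qed.

Lemma vb_automatic : is_automatic_word d -> exists r, vb_equals b xi r /\ is_rational r.
Proof.
case=> k [h [a [tau [u [hk [hu [/ltP ak [fix_u du]]]]]]]].
apply: (vb_of_gap_ratios _ du) => [|c Hc].
  by exists Z0, (Zpos xH); split=> //; rewrite /Rdiv Rmult_0_l.
have Z_inf := digit_not_cofinite du Hc.
have [g [[g_lt u_pref grow g_a] stab unif]] := stable_morphism hk ak fix_u (fun x => tau x == c).
have [K K1 HK] := unif hu.
apply: (run_family g_lt ak u_pref grow g_a stab Z_inf (q := 1)) => // -[|//] _.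
exact: (gap_ratio_rational g_lt ak u_pref grow g_a stab K1 HK).
Qed.

Lemma vb_morphic : is_morphic_word d -> exists r, vb_equals b xi r /\ is_algebraic r.
Proof.
case=> k [h [a [tau [u [hk [/ltP ak [fix_u du]]]]]]].
apply: (vb_of_gap_ratios _ du) => [|c Hc].
  (* The polynomial [X] witnesses that [0] is algebraic. *)
  exists [:: Z0; Zpos xH]; split; first by exists (Zpos xH); split=> //; right; left.
  by rewrite /eval_Zpoly /= Rmult_0_l Rplus_0_r.
have Z_inf := digit_not_cofinite du Hc.
have [g [[g_lt u_pref grow g_a] stab unif]] := stable_morphism hk ak fix_u (fun x => tau x == c).
have [q [q0 Hq]] := gap_ratio_algebraic g_lt ak u_pref grow g_a stab.
by apply: (run_family g_lt ak u_pref grow g_a stab Z_inf q0) => s _.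
Qed.
End Words.
End MorphicWord.

Theorem theorem1 (xi : R) (b : nat) (d : nat -> nat) :
  ~ is_rational xi -> (2 <= b)%nat -> is_base_expansion b xi d ->
  (is_automatic_word d -> exists r, vb_equals b xi r /\ is_rational r) /\
  (is_morphic_word d -> exists r, vb_equals b xi r /\ is_algebraic r).
Proof.
intros Hxi Hb Hd. split.
- exact (MorphicWord.vb_automatic Hxi Hb Hd).
- exact (MorphicWord.vb_morphic Hxi Hb Hd).
Qed.
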